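(* For every $\eta>0$ there exists $\mu>0$ such that the following holds for all sufficiently large $n$ with $n\equiv 1,3 \pmod 6$. For every $2$-edge-colouring of $K_n^{(3)}$, at least one of the following holds: (a) there is a Steiner triple system of order $n$ with at least $\frac{1}{2}\cdot\frac{1}{3}\binom{n}{2}+\mu n^2$ edges of the same colour; (b) there is a partition $[n]=X\cup Y$ with $|X|=\left\lfloor \frac{3+\sqrt{3}}{6}\,n\right\rfloor$ such that, for one of the two ways of naming the two colours ''red'' and ''blue'', the given colouring can be obtained by switching the colour of at most $\eta n^3$ triples in the colouring in which every triple intersecting both $X$ and $Y$ is blue and every other triple (i.e. contained in $X$ or contained in $Y$) is red.
   Context: $[n]=\{1,\dots,n\}$. $K_n^{(3)}$ is the complete $3$-uniform hypergraph on vertex set $[n]$, whose edges are all $3$-subsets (triples) of $[n]$. A $2$-edge-colouring of $K_n^{(3)}$ is an arbitrary assignment of one of two colours to each triple. A Steiner triple system of order $n$ is a set $\mathcal{S}$ of $3$-subsets of $[n]$ such that every $2$-subset of $[n]$ is contained in exactly one of the triples of $\mathcal{S}$; its triples are called its edges. ''Sufficiently large'' may depend on $\eta$ and $\mu$. *)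

(* Defs.v *)
From HB Require Import structures.
From mathcomp Require Import all_boot all_order all_algebra.
From mathcomp Require Import reals.

Set Implicit Arguments.
Unset Strict Implicit.
Unset Printing Implicit Defensive.

Import Order.TTheory GRing.Theory Num.Theory.

(* The vertex set [n] is 'I_n. *)
Definition triples (n : nat) : {set {set 'I_n}} := [set t : {set 'I_n} | #|t| == 3].

Definition is_steiner_triple_system (n : nat) (S : {set {set 'I_n}}) : Prop :=
  S \subset triples n /\
  forall e : {set 'I_n}, #|e| = 2 -> #|[set t in S | e \subset t]| = 1.

(* The two colours are the two booleans.  Only the values of a colouring on
   [triples n] are ever used; its values on other sets are irrelevant. *)
Definition colouring (n : nat) : Type := {set 'I_n} -> bool.

Definition edges_of_colour (n : nat) (c : colouring n) (b : bool)
    (S : {set {set 'I_n}}) : {set {set 'I_n}} :=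
  [set t in S | c t == b].

Definition meets (n : nat) (t X : {set 'I_n}) : bool := t :&: X != set0.

(* [red] is the boolean that is called red; the other one, [~~ red], is blue. *)
Definition split_colouring (n : nat) (X Y : {set 'I_n}) (red : bool) :
    colouring n :=
  fun t => if meets t X && meets t Y then ~~ red else red.

Definition switched_triples (n : nat) (c c' : colouring n) : {set {set 'I_n}} :=
  [set t in triples n | c t != c' t].

(* Main.v *)
Require Import Defs.
From HB Require Import structures.
From mathcomp Require Import all_boot all_order all_algebra all_fingroup.
From mathcomp Require Import reals.
From mathcomp Require Import zify ring lra.

Set Implicit Arguments.
Unset Strict Implicit.
Unset Printing Implicit Defensive.

Import Order.TTheory GRing.Theory Num.Theory.

(** Take a fixed Steiner triple system and relabel its points by a random
permutation: the expected proportion of triples of a given colour is the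
density of that colour among all triples.  So a colour of density at least
[1/2 + delta] has the required excess in some relabelling.

For the other source of excess, call six points in three antipodal pairs an
octahedron.  Its eight faces split into two classes of four, such that each
edge between non-antipodal points lies in one face of each class.  If a triple
system contains the four even faces (a Pasch configuration), it can exchange
them for the odd ones.  Let the system contain at least [n ^ 2 / 1000] Pasch
configurations, no two with a common triple; then all of them can be switched
independently of each other, each in the direction that favours the chosen
colour.  A random relabelling makes every one of them a random octahedron, and
if a proportion [delta] of all octahedra is unbalanced (the numbers of even and
odd faces of the chosen colour differ), the choices gain about
[delta * n ^ 2 / 2000] triples over the average ([sts_beats_average]).  Such
triple systems exist for every large admissible order: a Skolem construction
for orders [6 t + 1], its doubling for orders [12 s + 3], and a Bose
construction blown up by 2 for orders [12 u + 9] ([exists_pasch_rich]).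

What is left is a colouring in which both densities are close to 1/2 and almost
all octahedra are balanced ([stability]).  Averaging and the Ramsey theorem for
triples give six points [B] spanning triples of one colour, say colour 0, such
that for almost all [p, q, r] all octahedra inside [B] and [p, q, r] are
balanced ([base_exists], [link3_ramsey]).  The link of [p] in [B] then satisfies
the four-cycle relation [link_four_cycle], which makes it constant off one
point of [B] ([profile_exists]); this constant assigns [p] to a side.  Further
octahedra express the colour of [p, q, r] through the sides and through the
colours of [p, q, b] for [b] in [B] ([generic_sum]).  Except for rare pairs
[p, q] the latter are determined by the sides ([exceptional_star] and the
Cauchy-Schwarz inequality), and the colouring turns out to be
the one that separates triples meeting both sides from the others.  As its
density is close to 1/2, the larger side has about [(3 + sqrt 3) / 6 * n]
points ([side_size]), and moving a few points makes the size exact. *)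

(** * Steiner triple systems and Pasch switches *)

Section Designs.
Variable T : finType.
Implicit Types (x y z : T) (S A B : {set {set T}}) (s : seq T) (t : {set T}).

Definition tri x y z : {set T} := [set x; y; z].

Definition cover_count S x y : nat := #|[set t in S | (x \in t) && (y \in t)]|.

Definition sts S : Prop :=
  (forall t, t \in S -> #|t| = 3) /\
  (forall x y, x != y -> cover_count S x y = 1).

(** The list [x, x', y, y', z, z'] stands for the octahedron with antipodal pairs
[x x'], [y y'], [z z']; a face is even if it has an even number of primes. *)
Definition even_faces s : seq {set T} :=
  if s is [:: x; x'; y; y'; z; z'] then
    [:: tri x y z; tri x y' z'; tri x' y z'; tri x' y' z] else [::].

Definition odd_faces s : seq {set T} :=
  if s is [:: x; x'; y; y'; z; z'] then
    [:: tri x' y' z'; tri x' y z; tri x y' z; tri x y z'] else [::].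

Lemma card_tri x y z : uniq [:: x; y; z] -> #|tri x y z| = 3.
Proof.
move=> u; rewrite /tri -setUA !cardsU1 cards1 !inE.
by move: u; rewrite /= !inE => /andP[-> /andP[-> _]].
Qed.

Lemma tri_perm12 x y z : tri x y z = tri y x z.
Proof. by rewrite /tri (setUC [set x]). Qed.

Lemma tri_perm23 x y z : tri x y z = tri x z y.
Proof. by rewrite /tri -!setUA (setUC [set y]). Qed.

(** Sums of indicators turn incidences into polynomial identities. *)
Lemma tri_ind x y z u : uniq [:: x; y; z] ->
  (u \in tri x y z) = (u == x) + (u == y) + (u == z) :> nat.
Proof.
rewrite /= !inE; case: (eqVneq u x) => [->|_] /=.
  by case/andP => /norP[/negPf-> /negPf->].
by case: (eqVneq u y) => [->|_] //= /and3P[_ /negPf-> _].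
Qed.

(** This is what makes a switch possible: both classes of faces cover the same
pairs, the non-antipodal ones, once each. *)
Lemma faces_cover s x y : uniq s -> x != y ->
  count (fun t => (x \in t) && (y \in t)) (even_faces s) =
  count (fun t => (x \in t) && (y \in t)) (odd_faces s).
Proof.
case: s => [|a [|a' [|b [|b' [|c [|c' [|? ?]]]]]]] // us xy.
rewrite /= !inE !negb_or -!andbA in us.
case/and5P: us => n1 n2 n3 n4 /and5P[n5 n6 n7 n8] /and5P[n9 n10 n11 n12].
case/and4P=> n13 n14 n15 _.
have E : forall u v w, u != v -> u != w -> v != w -> forall z : T,
    (z \in tri u v w) = (z == u) + (z == v) + (z == w) :> nat.
  move=> u v w uv uw vw z; apply: tri_ind.
  by rewrite /= !inE negb_or uv uw vw.
have M : forall p q : bool, (p && q) = p * q :> nat by case; case.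
by cbn [count even_faces odd_faces]; rewrite !M !E //; ring.
Qed.

Lemma uniq_faces s : uniq s -> uniq (even_faces s ++ odd_faces s).
Proof.
case: s => [|a [|a' [|b [|b' [|c [|c' [|? ?]]]]]]] // us.
rewrite /= !inE !negb_or -!andbA in us.
case/and5P: us => n1 n2 n3 n4 /and5P[n5 n6 n7 n8] /and5P[n9 n10 n11 n12].
case/and4P=> n13 n14 n15 _.
(* A face is determined by which of the three unprimed points it contains. *)
apply: (@map_uniq _ _ (fun t => (a \in t, b \in t, c \in t))).
have F (u v : T) : u != v -> ((u == v) = false) * ((v == u) = false).
  by move=> uv; rewrite (eq_sym v) (negPf uv).
by rewrite /= !inE !eqxx /= ?(F _ _ n1) ?(F _ _ n2) ?(F _ _ n3) ?(F _ _ n4)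
  ?(F _ _ n5) ?(F _ _ n6) ?(F _ _ n7) ?(F _ _ n8) ?(F _ _ n9) ?(F _ _ n10)
  ?(F _ _ n11) ?(F _ _ n12) ?(F _ _ n13) ?(F _ _ n14) ?(F _ _ n15) /=.
Qed.

Lemma count_set (l : seq {set T}) (g : pred {set T}) : uniq l ->
  #|[set t in l | g t]| = count g l.
Proof.
move=> ul; rewrite -size_filter -(card_uniqP (filter_uniq g ul)).
by apply: eq_card => t; rewrite inE mem_filter andbC.
Qed.

Lemma face_pair s t : uniq s -> t \in even_faces s ++ odd_faces s ->
  #|t| = 3 /\ exists x y, [/\ x != y, x \in t & y \in t].
Proof.
case: s => [|a [|a' [|b [|b' [|c [|c' [|? ?]]]]]]] // us.
rewrite /= !inE !negb_or -!andbA in us.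
case/and5P: us => n1 n2 n3 n4 /and5P[n5 n6 n7 n8] /and5P[n9 n10 n11 n12].
case/and4P=> n13 n14 n15 _.
have E : forall u v w, u != v -> u != w -> v != w -> t = tri u v w ->
    #|t| = 3 /\ exists x y, [/\ x != y, x \in t & y \in t].
  move=> u v w uv uw vw ->; split.
    by apply: card_tri; rewrite /= !inE negb_or uv uw vw.
  by exists u, v; rewrite uv !inE !eqxx orbT.
rewrite /= !inE => /orP[|/orP[|/orP[|/orP[|/orP[|/orP[|/orP[|]]]]]]] /eqP; exact: E.
Qed.

Definition switch S s :=
  (S :\: [set t in even_faces s]) :|: [set t in odd_faces s].

(** An odd face shares a pair with some even face, and in a Steiner triple system
that pair lies in the even face only. *)
Lemma odd_notin_sts S s t : sts S -> uniq s -> {subset even_faces s <= S} ->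
  t \in odd_faces s -> t \notin S.
Proof.
move=> [_ covS] us sS todd; apply/negP => tS.
have [|_ [x [y [xy xt yt]]]] := face_pair us (t := t).
  by rewrite mem_cat todd orbT.
have : has (fun t => (x \in t) && (y \in t)) (even_faces s).
  rewrite has_count faces_cover // -has_count; apply/hasP.
  by exists t; rewrite ?xt.
case/hasP => t' t'ev /andP[xt' yt'].
suff tt' : t = t'.
  have := uniq_faces us; rewrite cat_uniq => /and3P[_ /hasPn/(_ t todd)/=].
  by rewrite tt' t'ev.
have /eqP/cards1P[u Su] := covS _ _ xy.
have : t \in [set u] by rewrite -Su inE tS xt yt.
have : t' \in [set u] by rewrite -Su inE (sS _ t'ev) xt' yt'.
by rewrite !inE => /eqP-> /eqP->.
Qed.

Lemma switch_count S s (g : pred {set T}) : sts S -> uniq s ->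
  {subset even_faces s <= S} ->
  #|[set t in switch S s | g t]| + count g (even_faces s) =
  #|[set t in S | g t]| + count g (odd_faces s).
Proof.
move=> stsS us sS.
have := uniq_faces us; rewrite cat_uniq => /and3P[uE _ uO].
rewrite -!count_set //.
have -> : [set t in switch S s | g t] =
    ([set t in S | g t] :\: [set t in even_faces s | g t])
      :|: [set t in odd_faces s | g t].
  by apply/setP => t; rewrite !inE; case: (g t); rewrite ?andbF ?andbT.
rewrite cardsU; have -> : ([set t in S | g t] :\: [set t in even_faces s | g t])
    :&: [set t in odd_faces s | g t] = set0.
  apply/setP => t; rewrite !inE; case todd: (t \in odd_faces s); rewrite ?andbF //.
  by rewrite (negPf (odd_notin_sts stsS us sS todd)) /= andbF.
have sub : [set t in even_faces s | g t] \subset [set t in S | g t].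
  by apply/subsetP => t; rewrite !inE => /andP[/sS-> ->].
by rewrite cards0 subn0 cardsD (setIidPr sub) addnAC subnK // subset_leq_card.
Qed.

Lemma sts_switch S s : sts S -> uniq s -> {subset even_faces s <= S} ->
  sts (switch S s).
Proof.
move=> stsS us sS; have [S3 Sc] := stsS; split=> [t|x y xy].
  rewrite !inE => /orP[/andP[_ /S3] //|todd].
  by have [|-> //] := face_pair us (t := t); rewrite mem_cat todd orbT.
have := switch_count (fun t => (x \in t) && (y \in t)) stsS us sS.
by rewrite faces_cover // -!/(cover_count _ _ _) Sc // => /addIn.
Qed.

(** Pairwise face-disjoint Pasch configurations can be switched independently,
so each of them contributes its gain when that gain is positive. *)
Lemma switch_many (g : pred {set T}) (l : seq (seq T)) S : sts S ->
  (forall s, s \in l -> uniq s /\ {subset even_faces s <= S}) ->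
  pairwise (fun s s' => ~~ has (mem (even_faces s)) (even_faces s')) l ->
  exists2 S', sts S' &
    #|[set t in S | g t]| +
      \sum_(s <- l) (count g (odd_faces s) - count g (even_faces s))
    <= #|[set t in S' | g t]|.
Proof.
elim: l S => [|s l IH] S stsS lS; first by exists S; rewrite // big_nil addn0.
rewrite pairwise_cons => /andP[/allP dis pw]; rewrite big_cons.
have [us sS] := lS s (mem_head _ _).
have [|lt] := leqP (count g (odd_faces s)) (count g (even_faces s)).
  rewrite -subn_eq0 => /eqP->; rewrite add0n; apply: IH => // s' s'l.
  by apply: lS; rewrite inE s'l orbT.
have [] := IH (switch S s) (sts_switch stsS us sS) _ pw.
  move=> s' s'l; have [us' s'S] := lS s' (mem_behead (s := s :: l) s'l).
  split=> // t ts'; rewrite !inE s'S //.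
  by have /hasPn/(_ t ts')/= -> := dis s' s'l.
move=> S' stsS' le; exists S' => //; apply: leq_trans le.
by rewrite addnA leq_add2r; have := switch_count g stsS us sS; lia.
Qed.
End Designs.

(** * Averaging over permutations *)

Lemma perm_between (T : finType) (s t : seq T) : uniq s -> uniq t ->
  size s = size t -> exists r : {perm T}, map r t = s.
Proof.
move=> us ut st.
have ext (u : seq T) : uniq u ->
    exists2 u', perm_eq (u ++ u') (enum T) & size u + size u' = #|T|.
  move=> uu; set u' := [seq x <- enum T | x \notin u].
  have pu : perm_eq (u ++ u') (enum T).
    apply: uniq_perm; rewrite ?enum_uniq //; last first.
      by move=> x; rewrite mem_cat mem_filter mem_enum andbT orbN.
    rewrite cat_uniq uu filter_uniq ?enum_uniq // andbT /=.
    by apply/hasPn => x; rewrite mem_filter => /andP[].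
  by exists u'; rewrite // -size_cat (perm_size pu) -cardT.
have [s' ps ns] := ext s us; have [t' pt nt] := ext t ut.
case: s us st ps ns => [|x0 s] us st ps ns.
  by exists 1%g; rewrite (size0nil (esym st)).
set S := (x0 :: s) ++ s' in ps; set R := t ++ t' in pt.
have uS : uniq S by rewrite (perm_uniq ps) enum_uniq.
have uR : uniq R by rewrite (perm_uniq pt) enum_uniq.
have mR x : x \in R by rewrite (perm_mem pt) mem_enum.
have sSR : size S = size R by rewrite !size_cat ns nt.
pose f x := nth x0 S (index x R).
have finj : injective f.
  move=> x y /eqP; rewrite /f nth_uniq ?sSR ?index_mem // => /eqP.
  by apply: index_inj.
exists (perm finj); apply: (@eq_from_nth _ x0); rewrite size_map // => i it.
rewrite (nth_map x0) // permE /f index_cat mem_nth // index_uniq //.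
by rewrite /S nth_cat st it.
Qed.

Lemma card_perms (T : finType) : #|{perm T}| = #|T|`!.
Proof.
rewrite -[#|T|]cardsT -card_perm; apply: eq_card => p.
by apply/esym/subsetP => x _; rewrite inE.
Qed.

Lemma card_uniq_seqs (T : finType) k :
  #|[set q : k.-tuple T | uniq q]| = #|T| ^_ k.
Proof.
rewrite -(card_uniq_tuples k (mem T)).
by apply: eq_card => q; rewrite !inE; have -> : all (mem T) q by apply/allP.
Qed.

(** A random permutation carries a fixed injective sequence to a uniformly random
one.  Written without division. *)
Lemma perm_avg (T : finType) k (F : seq T -> nat) (s : seq T) :
  uniq s -> size s = k ->
  #|T| ^_ k * (\sum_(p : {perm T}) F (map p s)) =
  #|T|`! * (\sum_(q : k.-tuple T | uniq q) F q).
Proof.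
move=> us sk.
rewrite -card_uniq_seqs.
rewrite -sum1_card big_distrl /=.
transitivity (\sum_(q : k.-tuple T | uniq q) \sum_(p : {perm T}) F (map p q)).
  rewrite big_mkcond [RHS]big_mkcond; apply: eq_bigr => q _; rewrite inE.
  case: ifP => // uq; rewrite mul1n.
  have [|r <-] := perm_between us uq; first by rewrite size_tuple.
  rewrite [RHS](reindex_inj (mulgI r)) /=; apply: eq_bigr => p _.
  by rewrite -map_comp; congr F; apply: eq_map => x /=; rewrite permM.
rewrite exchange_big /=.
transitivity (\sum_(p : {perm T}) \sum_(q : k.-tuple T | uniq q) F q); last first.
  by rewrite sum_nat_const card_perms.
apply: eq_bigr => p _.
rewrite [RHS](reindex (fun q : k.-tuple T => [tuple of map p q])) /=.
  by apply: eq_bigl => q; rewrite map_inj_uniq //; apply: perm_inj.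
exists (fun q : k.-tuple T => [tuple of map (p^-1)%g q]) => q _; apply: val_inj => /=.
  by rewrite -map_comp map_id_in // => x _ /=; rewrite permK.
by rewrite -map_comp map_id_in // => x _ /=; rewrite permKV.
Qed.

Lemma exists_ge_avg (I : finType) (F : I -> nat) c : 0 < #|I| ->
  #|I| * c <= \sum_i F i -> exists i, c <= F i.
Proof.
move=> I0 le; apply/existsP; apply: contraLR le; rewrite negb_exists => /forallP lt.
have [i0 _] : exists i0 : I, i0 \in I by apply/card_gt0P.
rewrite -ltnNge -sum_nat_const (bigD1 i0) //= [ltnRHS](bigD1 i0) //= -addSn.
rewrite leq_add ?ltnNge //.
by apply: leq_sum => p _; apply: ltnW; rewrite ltnNge.
Qed.

Lemma exists_le_avg (I : finType) (F : I -> nat) c : 0 < #|I| ->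
  \sum_i F i <= #|I| * c -> exists i, F i <= c.
Proof.
move=> I0 le; apply/existsP; apply: contraLR le; rewrite negb_exists => /forallP lt.
have [i0 _] : exists i0 : I, i0 \in I by apply/card_gt0P.
rewrite -ltnNge -sum_nat_const (bigD1 i0) //= [ltnRHS](bigD1 i0) //= -addSn.
rewrite leq_add ?ltnNge //.
by apply: leq_sum => p _; apply: ltnW; rewrite ltnNge.
Qed.

Lemma imset_tri (T T' : finType) (f : T -> T') x y z :
  f @: tri x y z = tri (f x) (f y) (f z).
Proof. by rewrite /tri !imsetU !imset_set1. Qed.

Lemma even_faces_map (T T' : finType) (f : T -> T') s :
  even_faces (map f s) = [seq f @: (t : {set T}) | t <- even_faces s].
Proof.
by case: s => [|a [|a' [|b [|b' [|c [|c' [|? ?]]]]]]] //=; rewrite !imset_tri.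
Qed.

Definition set_image (T T' : finType) (f : T -> T') (S : {set {set T}}) :=
  [set f @: (t : {set T}) | t in S].

Lemma sts_image (T T' : finType) (f : T -> T') S : bijective f -> sts S ->
  sts (set_image f S).
Proof.
move=> bf [S3 Sc]; have fi := bij_inj bf; split=> [t /imsetP[u uS ->]|x y xy].
  by rewrite card_imset ?S3.
have [g fK gK] := bf.
have gxy : g x != g y by rewrite (can_eq gK).
rewrite -(Sc _ _ gxy) /cover_count -(card_imset _ (imset_inj fi)).
apply: eq_card => t; apply/idP/idP.
  rewrite inE => /andP[/imsetP[u uS ->] /andP[xu yu]].
  apply: imset_f; rewrite inE uS.
  by rewrite -(mem_imset _ _ fi) gK xu -(mem_imset _ _ fi) gK yu.
case/imsetP => u /setIdP[uS /andP[xu yu]] ->.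
by rewrite inE imset_f // -[x]gK -[y]gK !(mem_imset _ _ fi) xu yu.
Qed.

(** The lists in [l] are octahedra with even faces in [S]; sharing no triple, they
can be switched one after the other. *)
Definition pasch_rich (T : finType) (m : nat) : Prop :=
  exists (S : {set {set T}}) (l : seq (seq T)),
    [/\ sts S, size l = m,
        forall s, s \in l ->
          [/\ uniq s, size s = 6 & {subset even_faces s <= S}]
      & pairwise (fun s s' => ~~ has (mem (even_faces s)) (even_faces s')) l].

Lemma pasch_rich_bij (T T' : finType) (f : T -> T') m : bijective f ->
  pasch_rich T m -> pasch_rich T' m.
Proof.
move=> bf [S [l [stsS sl lS pw]]]; have fi := bij_inj bf.
exists (set_image f S), (map (map f) l); split.
- exact: sts_image.
- by rewrite size_map.
- move=> _ /mapP[s sl' ->]; have [us s6 sS] := lS s sl'.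
  rewrite map_inj_uniq // size_map; split=> // t.
  by rewrite even_faces_map => /mapP[u us' ->]; apply/imset_f/sS.
- rewrite pairwise_map; apply: sub_pairwise pw => s s' /=; rewrite !even_faces_map.
  by move=> /hasPn dis; apply/hasPn => _ /mapP[u /dis/= us ->];
    rewrite /= mem_map //; apply: imset_inj.
Qed.

(** Count triples with an ordered pair of distinct points in them. *)
Lemma card_sts (T : finType) (S : {set {set T}}) : sts S ->
  6 * #|S| = #|T| * #|T|.-1.
Proof.
move=> [S3 Sc].
have pairs (A : {set T}) :
    \sum_(x in A) \sum_(y in A | x != y) 1 = #|A| * #|A|.-1.
  transitivity (\sum_(x in A) #|A|.-1); last by rewrite sum_nat_const.
  apply: eq_bigr => x xA; rewrite sum1_card (cardsD1 x A) xA /=.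
  by apply: eq_card => y; rewrite !inE eq_sym andbC.
transitivity (\sum_(t in S) \sum_(x in t) \sum_(y in t | x != y) 1).
  rewrite mulnC -sum_nat_const; apply: eq_bigr => t tS.
  by rewrite pairs S3.
rewrite -cardsT -pairs.
transitivity (\sum_x \sum_(y | x != y) cover_count S x y); last first.
  apply: eq_big => [x|x _]; first by rewrite inE.
  by apply: eq_big => [y|y xy]; rewrite ?inE // Sc.
transitivity (\sum_(t in S) \sum_x \sum_(y | x != y) ((x \in t) && (y \in t)) : nat).
  apply: eq_bigr => t _; rewrite big_mkcond; apply: eq_bigr => x _.
  case: (x \in t) => /=; last by rewrite big1_eq.
  rewrite big_mkcond [RHS]big_mkcond; apply: eq_bigr => y _.
  by case: (y \in t); case: (x != y).
rewrite exchange_big /=; apply: eq_bigr => x _.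
rewrite exchange_big /=; apply: eq_bigr => y _.
rewrite /cover_count -sum1_card [RHS]big_mkcond [LHS]big_mkcond /=.
by apply: eq_bigr => t _; rewrite inE; case: (t \in S) => //=; case: (_ && _).
Qed.

(** * Steiner triple systems beating the average *)

Definition tri_holds (T : finType) (g : pred {set T}) (s : seq T) : bool :=
  if s is [:: x; y; z] then g (tri x y z) else false.

Definition triple_count (T : finType) (g : pred {set T}) : nat :=
  #|[set q : 3.-tuple T | uniq q & tri_holds g q]|.

Definition unbalanced (T : finType) (g : pred {set T}) (s : seq T) : bool :=
  count g (even_faces s) != count g (odd_faces s).

Definition unbalanced_count (T : finType) (g : pred {set T}) : nat :=
  #|[set q : 6.-tuple T | uniq q & unbalanced g q]|.

Definition switch_gain (T : finType) (g : pred {set T}) (s : seq T) : nat :=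
  count g (odd_faces s) - count g (even_faces s).

Definition swap_first (T : Type) (s : seq T) : seq T :=
  if s is x :: x' :: r then x' :: x :: r else s.

Lemma swap_first_size (T : Type) n (q : n.-tuple T) : size (swap_first q) == n.
Proof. by case: q => [[|x [|x' r]]]. Qed.

Lemma swap_firstK (T : Type) : involutive (@swap_first T).
Proof. by case=> [|x [|x' r]]. Qed.

(** Exchanging two antipodal points turns a loss into a gain, so half of the
unbalanced octahedra yield a gain of at least one. *)
Lemma total_gain (T : finType) (g : pred {set T}) :
  unbalanced_count g <= 2 * \sum_(q : 6.-tuple T | uniq q) switch_gain g q.
Proof.
pose sw (q : 6.-tuple T) := Tuple (swap_first_size q).
have swK : involutive sw by move=> q; apply/val_inj/swap_firstK.
rewrite mul2n -addnn {2}(reindex_inj (inv_inj swK)) /=.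
have usw (q : 6.-tuple T) : uniq (swap_first q) = uniq q.
  case: q => [[|x [|x' r]] //= _]; rewrite !inE eq_sym !negb_or -!andbA.
  by do !bool_congr.
rewrite (eq_bigl _ _ usw) -big_split /= /unbalanced_count -sum1_card.
rewrite big_mkcond [leqRHS]big_mkcond /=; apply: leq_sum => q _; rewrite inE.
case: (uniq q) => //=; case: ifP => //; rewrite /unbalanced /switch_gain.
case: q => [[|a [|a' [|b [|b' [|c [|c' [|? ?]]]]]]]] //= _.
rewrite (tri_perm12 a); lia.
Qed.

(** A relabelling at least as good as the average one, where each Pasch
configuration is switched if that adds [g]-triples.  After
division by [2 * n ^_ 3 * n ^_ 6] the two summands are the density term and
[m / 2] times the proportion of unbalanced octahedra. *)
Lemma sts_beats_average (T : finType) (g : pred {set T}) m : pasch_rich T m ->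
  exists2 S, sts S &
    (#|S| * triple_count g) * #|T| ^_ 6 * 2 + m * unbalanced_count g * #|T| ^_ 3
      <= 2 * #|T| ^_ 3 * #|T| ^_ 6 * #|[set t in S | g t]|.
Proof.
move=> [S [l [stsS sl lS pw]]].
pose val (p : {perm T}) := #|[set t in set_image p S | g t]| +
   \sum_(s <- l) switch_gain g (map p s).
have ex p : exists2 S', sts S' & val p <= #|[set t in S' | g t]| /\ #|S'| = #|S|.
  have [] := @switch_many T g (map (map p) l) (set_image p S).
  - exact: sts_image (injF_bij (@perm_inj _ p)) stsS.
  - move=> _ /mapP[s sl' ->]; have [us s6 sS] := lS s sl'.
    rewrite map_inj_uniq; last exact: perm_inj.
    split=> // t.
    by rewrite even_faces_map => /mapP[u us' ->]; apply/imset_f/sS.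
  - rewrite pairwise_map; apply: sub_pairwise pw => s s' /=; rewrite !even_faces_map.
    by move=> /hasPn dis; apply/hasPn => _ /mapP[u /dis/= us ->];
      rewrite /= mem_map //; apply/imset_inj/perm_inj.
  move=> S' sS' le; exists S'; rewrite // /val; split; first by rewrite big_map in le.
  by have := card_sts sS'; rewrite -(card_sts stsS); lia.
have sumval : \sum_p val p * (#|T| ^_ 3 * #|T| ^_ 6 * 2) >=
    #|T|`! * ((#|S| * triple_count g) * #|T| ^_ 6 * 2 +
              m * unbalanced_count g * #|T| ^_ 3).
  rewrite -big_distrl /= /val big_split /=.
  have E1 : #|T| ^_ 3 * (\sum_(p : {perm T}) #|[set t in set_image p S | g t]|) =
      #|T|`! * (#|S| * triple_count g).
    transitivity (#|T| ^_ 3 * (\sum_(t in S) \sum_(p : {perm T}) g (p @: t))).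
      congr (_ * _); rewrite exchange_big /=; apply: eq_bigr => p _.
      transitivity #|[set p @: (t : {set T}) | t in [set t in S | g (p @: t)]]|.
        apply: eq_card => t; rewrite inE; apply/idP/imsetP.
          case/andP=> /imsetP[u uS ->] gu; exists u => //.
          by rewrite inE uS.
        by case=> u /setIdP[uS gu] ->; rewrite imset_f.
      rewrite card_imset; last by apply/imset_inj/perm_inj.
      rewrite -sum1_card big_mkcond [RHS]big_mkcond; apply: eq_bigr => t _.
      by rewrite inE; case: (t \in S) => //=; case: (g _).
    rewrite mulnCA -sum_nat_const !big_distrr /=; apply: eq_bigr => t tS.
    have := perm_avg (tri_holds g) (enum_uniq t) (k := 3).
    rewrite -cardE; case: stsS => S3 _; rewrite S3 // => /(_ erefl).
    have -> : \sum_(q : 3.-tuple T | uniq q) tri_holds g q = triple_count g.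
      rewrite /triple_count -sum1_card big_mkcond [RHS]big_mkcond.
      by apply: eq_bigr => q _; rewrite inE; case: (uniq q) => //=; case: (tri_holds _ _).
    move=> <-; congr (_ * _); apply: eq_bigr => p _.
    have := S3 t tS; rewrite cardE; have : [set x in enum t] = t.
      by apply/setP => x; rewrite inE mem_enum.
    case: (enum t) => [|x [|y [|z [|? ?]]]] //= <- _; congr (nat_of_bool (g _)).
    have -> : [set u in [:: x; y; z]] = tri x y z.
      by apply/setP => u; rewrite !inE orbA.
    by rewrite imset_tri.
  have E2 : #|T|`! * (m * unbalanced_count g) <=
      2 * (#|T| ^_ 6 * (\sum_(p : {perm T}) \sum_(s <- l) switch_gain g (map p s))).
    rewrite exchange_big /= big_distrr big_distrr /=.
    rewrite -sl -sum1_size big_distrl big_distrr /=.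
    rewrite big_seq [leqRHS]big_seq; apply: leq_sum => s /lS[us s6 _].
    rewrite (perm_avg (switch_gain g) us s6) mul1n mulnCA leq_mul2l total_gain.
    by rewrite orbT.
  move: E1 E2; set X := \sum_p _; set Y := \sum_p _; move: (#|T|`!) => f.
  move: (#|T| ^_ 3) (#|T| ^_ 6) (#|S| * _) (m * _) => a b s u E1 E2.
  rewrite mulnDr mulnDl.
  have -> : f * (s * b * 2) = X * (a * b * 2) by rewrite mulnA mulnA -E1; ring.
  rewrite leq_add2l.
  have -> : f * (u * a) = a * (f * u) by ring.
  have -> : Y * (a * b * 2) = a * (2 * (b * Y)) by ring.
  by rewrite leq_mul2l E2 orbT.
have [p le] : exists p, (#|S| * triple_count g) * #|T| ^_ 6 * 2 +
              m * unbalanced_count g * #|T| ^_ 3 <= val p * (#|T| ^_ 3 * #|T| ^_ 6 * 2).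
  by apply: exists_ge_avg; rewrite card_perms ?fact_gt0.
have [S' sS' [vS' cS']] := ex p; exists S' => //.
rewrite cS'; apply: leq_trans le _.
have -> : 2 * #|T| ^_ 3 * #|T| ^_ 6 * #|[set t in S' | g t]| =
   #|[set t in S' | g t]| * (#|T| ^_ 3 * #|T| ^_ 6 * 2) by ring.
by rewrite leq_mul2r vS' orbT.
Qed.

(** * Steiner quasigroups with many Pasch configurations *)

Definition steiner_op (V : Type) (op : V -> V -> V) : Prop :=
  [/\ idempotent_op op, commutative op & forall x y, op x (op x y) = y].

Definition op_blocks (V : finType) (op : V -> V -> V) : {set {set V}} :=
  [set t | [exists x, exists y, (x != y) && (t == tri x y (op x y))]].

Lemma op_blocksP (V : finType) (op : V -> V -> V) t :
  reflect (exists x y, x != y /\ t = tri x y (op x y)) (t \in op_blocks op).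
Proof.
rewrite inE; apply: (iffP existsP) => [[x /existsP[y /andP[xy /eqP->]]]|].
  by exists x, y.
by case=> x [y [xy ->]]; exists x; apply/existsP; exists y; rewrite xy eqxx.
Qed.

Lemma steiner_op_neq (V : eqType) (op : V -> V -> V) x y : steiner_op op ->
  x != y -> uniq [:: x; y; op x y].
Proof.
move=> [opI opC opK] xy; rewrite /= !inE negb_or xy /= andbT.
apply/andP; split; apply: contraNneq xy => e.
  by rewrite -(opK x y) -e opI.
by rewrite -(opK y x) opC (opC y) opC -e opI.
Qed.

(** Idempotent, commutative, and [op x] an involution: exactly the laws of the
operation that sends two points to the third point of their triple. *)
Lemma sts_op_blocks (V : finType) (op : V -> V -> V) : steiner_op op ->
  sts (op_blocks op).
Proof.
move=> sop; have [opI opC opK] := sop.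
split=> [t /op_blocksP[x [y [xy ->]]]|x y xy].
  exact/card_tri/steiner_op_neq.
apply/eqP/cards1P; exists (tri x y (op x y)); apply/setP => t.
rewrite inE [RHS]inE; apply/idP/eqP => [|->]; last first.
  have -> : tri x y (op x y) \in op_blocks op by apply/op_blocksP; exists x, y.
  by rewrite !inE !eqxx orbT.
case/andP=> /op_blocksP[u [v [uv ->]]].
have K1 : op v (op u v) = u by rewrite opC (opC u) opC opK.
have K2 : op (op u v) u = v by rewrite opC opK.
have K3 : op (op u v) v = u by rewrite opC K1.
rewrite !inE -!orbA => /andP[].
move=> /or3P[] /eqP ex /or3P[] /eqP ey; move: xy; rewrite ex ey ?eqxx // => _.
- by rewrite opK tri_perm23.
- by rewrite (opC v) tri_perm12.
- by rewrite K1 tri_perm12 tri_perm23.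
- by rewrite K2 tri_perm23 tri_perm12.
- by rewrite K3 tri_perm12 tri_perm23 tri_perm12.
Qed.

(** A Steiner quasigroup with [u * u] Pasch configurations: for each [k] and [l]
the four triples through one of [X k], [X' k] and one of [Y l], [Y' l].  The
labels of the points of any one of the four triples tell which [k] and [l] it
comes from, so that no triple is shared. *)
Record pasch_grid (V : Type) (u : nat) : Type := PaschGrid {
  grid_op : V -> V -> V;
  grid_label : V -> nat;
  gridX : 'I_u -> V;
  gridX' : 'I_u -> V;
  gridY : 'I_u -> V;
  gridY' : 'I_u -> V;
  grid_steiner : steiner_op grid_op;
  gridX_neq : forall k, gridX k <> gridX' k;
  gridY_neq : forall l, gridY l <> gridY' l;
  labelX : forall k, grid_label (gridX k) = k;
  labelX' : forall k, grid_label (gridX' k) = k;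
  labelY : forall l, grid_label (gridY l) = u + l;
  labelY' : forall l, grid_label (gridY' l) = u + l;
  label_op : forall k l, grid_label (grid_op (gridX k) (gridY l)) = 2 * u;
  label_op' : forall k l, grid_label (grid_op (gridX k) (gridY' l)) = 2 * u;
  grid_opE : forall k l,
    grid_op (gridX' k) (gridY' l) = grid_op (gridX k) (gridY l);
  grid_opE' : forall k l,
    grid_op (gridX' k) (gridY l) = grid_op (gridX k) (gridY' l)
}.

Lemma pasch_grid_rich (V : finType) (u : nat) :
  pasch_grid V u -> pasch_rich V (u * u).
Proof.
case=> op lab X X' Y Y' sop nX nY lX lX' lY lY' lZ lZ' eZ eZ'.
have [opI opC opK] := sop.
have XX' k : X k != X' k by apply/eqP.
have YY' l : Y l != Y' l by apply/eqP.
pose P (kl : 'I_u * 'I_u) := let: (k, l) := kl in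
  [:: X k; X' k; Y l; Y' l; op (X k) (Y l); op (X k) (Y' l)].
have labE k l t : t \in even_faces (P (k, l)) ->
    [/\ exists2 v, v \in t & lab v = k, exists2 v, v \in t & lab v = u + l
      & forall v, v \in t -> [\/ lab v = k, lab v = u + l | lab v = 2 * u]].
  have E x y z : lab x = k -> lab y = u + l -> lab z = 2 * u -> t = tri x y z ->
    [/\ exists2 v, v \in t & lab v = k, exists2 v, v \in t & lab v = u + l
      & forall v, v \in t -> [\/ lab v = k, lab v = u + l | lab v = 2 * u]].
    move=> lx ly lz ->; split; [exists x|exists y|move=> v] => //;
      rewrite ?inE ?eqxx ?orbT //.
    by rewrite -orbA => /or3P[] /eqP->; [apply: Or31|apply: Or32|apply: Or33].
  by rewrite !inE => /or4P[] /eqP; apply: E.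
exists (op_blocks op), (map P (enum {: 'I_u * 'I_u})); split.
- exact: sts_op_blocks.
- by rewrite size_map -cardT card_prod card_ord.
- move=> _ /mapP[[k l] _ ->]; split=> //.
    have L v w : lab v != lab w -> v != w by apply: contraNneq => ->.
    have [kl kl'] := (ltn_ord k, ltn_ord l).
    have Z : op (X k) (Y l) != op (X k) (Y' l).
      by apply: contraNneq (YY' l) => e; rewrite -(opK (X k) (Y l)) e opK.
    rewrite /= !inE !negb_or XX' YY' Z /= !andbT.
    by do !(apply/andP; split); apply: L; rewrite ?lX ?lX' ?lY ?lY' ?lZ ?lZ'; lia.
  have L v w : lab v != lab w -> v != w by apply: contraNneq => ->.
  have [kl kl'] := (ltn_ord k, ltn_ord l).
  move=> t; rewrite !inE => /or4P[] /eqP->; apply/existsP.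
  + exists (X k); apply/existsP; exists (Y l).
    by rewrite eqxx andbT; apply: L; rewrite lX lY; lia.
  + exists (X k); apply/existsP; exists (Y' l).
    by rewrite eqxx andbT; apply: L; rewrite lX lY'; lia.
  + exists (X' k); apply/existsP; exists (Y l).
    by rewrite eZ' eqxx andbT; apply: L; rewrite lX' lY; lia.
  + exists (X' k); apply/existsP; exists (Y' l).
    by rewrite eZ eqxx andbT; apply: L; rewrite lX' lY'; lia.
rewrite pairwise_map; have := enum_uniq {: 'I_u * 'I_u}; rewrite uniq_pairwise.
apply: sub_pairwise => -[k l] [k' l'] neq; apply/hasPn => t t'in.
apply: contraNN neq => tin.
have [[v vt lv] [w wt lw] _] := labE k' l' t t'in.
have [_ _ only] := labE k l t tin.
have [klt klt' llt llt'] := And4 (ltn_ord k) (ltn_ord k') (ltn_ord l) (ltn_ord l').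
rewrite xpair_eqE -!val_eqE /=; move: klt klt' llt llt'.
by case: (only v vt); case: (only w wt); rewrite lv lw; lia.
Qed.


Lemma Z3P (i j : 'Z_3) : [\/ j = i, j = i + 1 | j = i - 1]%R.
Proof.
suff : [|| j == i, j == i + 1 | j == i - 1]%R.
  by case/or3P => /eqP; [apply: Or31|apply: Or32|apply: Or33].
by move: i j => [[|[|[|i]]] ?] [[|[|[|j]]] ?].
Qed.

Lemma Z3E (i : 'Z_3) :
  ((i + 1 == i)%R = false) * ((i == i + 1)%R = false) *
  ((i - 1 == i)%R = false) * ((i == i - 1)%R = false) *
  ((i - 1 == i + 1)%R = false) * ((i + 1 == i - 1)%R = false) *
  (i + 1 + 1 = i - 1)%R * (i - 1 - 1 = i + 1)%R *
  (i - 1 + 1 = i)%R * (i + 1 - 1 = i)%R.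
Proof.
by do !split; try (apply: val_inj); move: i => [[|[|[|i]]] ?].
Qed.

Section InflatedBose.
Local Open Scope ring_scope.
Variables (R : zmodType) (half : R -> R).
Hypothesis half_double : forall x, half (x + x) = x.
Hypothesis double_half : forall x, half x + half x = x.

Local Notation point := ('Z_3 + (bool * R * 'Z_3))%type.

(** A point is [inl i], one of the three new ones, or [inr (a, x, i)], copy [a] of
the Bose point [x] on level [i].  Triples with equal [x] live in an affine plane
over the field with three elements: its rows are the new points and the two
copies, and the third point of a line is minus the sum of the other two.  The
remaining triples join two points of one level to one on the next; they come in
fours, one for each choice of two copies, and these fours are Pasch
configurations. *)
Definition bose_op (p q : point) : point :=
  match p, q with
  | inl i, inl j => inl (- (i + j))
  | inl i, inr (a, x, j) | inr (a, x, j), inl i => inr (~~ a, x, - (i + j))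
  | inr (a, x, i), inr (b, y, j) =>
      if x == y then
        if a == b then inr (a, x, - (i + j)) else inl (- (i + j))
      else if i == j then inr (a (+) b, half (x + y), i + 1)
      else if j == i + 1 then inr (a (+) b, y + y - x, i)
      else inr (a (+) b, x + x - y, j)
  end.

Lemma Z3_third (i j : 'Z_3) : - (i + - (i + j)) = j.
Proof. by rewrite opprB addrC addKr. Qed.

Lemma bose_steiner : steiner_op bose_op.
Proof.
have dI (x y : R) : x + x = y + y -> x = y.
  by move=> e; rewrite -[x]half_double e half_double.
split.
- move=> [i|[[a x] i]] /=; rewrite ?eqxx; [congr inl|congr (inr (_, _, _))];
    by apply: val_inj; move: i => [[|[|[|i]]] ?].
- move=> [i|[[a x] i]] [j|[[b y] j]] //=; rewrite 1?(addrC i) // (eq_sym y) (eq_sym b).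
  case: (eqVneq x y) => [->|xy]; first by case: (eqVneq a b) => [->|].
  rewrite (eq_sym j) addbC (addrC x).
  by case: (Z3P i j) => ->; rewrite ?eqxx ?Z3E ?eqxx.
move=> [i|[[a x] i]] [j|[[b y] j]] /=; rewrite ?Z3_third ?negbK //.
- by rewrite eqxx; case: a => /=; rewrite [j + i]addrC Z3_third.
- case: (eqVneq x y) => [->|xy].
    case: (eqVneq a b) => [->|ab] /=; first by rewrite !eqxx Z3_third.
    by rewrite [_ + i]addrC Z3_third; move: ab; case: a; case: b.
  have [-> | -> | ->] := Z3P i j; rewrite ?eqxx ?Z3E /=.
  + have -> : (x == half (x + y)) = false.
      apply: contraNF xy => /eqP e; apply/eqP/(addrI x).
      by rewrite -[RHS]double_half -e.
    by rewrite double_half addKb [x + y]addrC addrK.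
  + have -> : (x == y + y - x) = false.
      by apply: contraNF xy => /eqP e; apply/eqP/dI; rewrite {1}e subrK.
    by rewrite eqxx addKb [x + _]addrC subrK half_double.
  + have -> : (x == x + x - y) = false.
      apply: contraNF xy => /eqP e; apply/eqP/(addrI x).
      by rewrite -[LHS](subrK y) -e.
    by rewrite addKb opprB addrC subrK.
Qed.
End InflatedBose.


Section Skolem.
Local Open Scope ring_scope.
Variables (R : zmodType) (sigma tau : R -> R) (e : R).
Hypothesis sigmaK : cancel sigma tau.
Hypothesis tauK : cancel tau sigma.
Hypothesis e_neq0 : e != 0.
Hypothesis ee : e + e = 0.
Hypothesis sigma_double : forall x, sigma (x + x) = x \/ sigma (x + x) = x + e.

Local Notation point := (option (R * 'Z_3)).

(** Skolem's construction, for the half-idempotent commutative quasigroup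
[sigma (x + y)]: for each [x], one of [x] and [x + e] is idempotent.  Triples
are [x, y] on one level with [sigma (x + y)] on the next; the three copies of an
idempotent [x]; and the new point [None] with a non-idempotent [x] and
[x + e] on the next level.  In [skolem_up] the points [x] and [y] lie on
consecutive levels. *)
Definition skolem_inf (x : R) (i : 'Z_3) : point :=
  if sigma (x + x) == x then Some (x + e, i - 1) else Some (x + e, i + 1).

Definition skolem_up (x : R) (i : 'Z_3) (y : R) : point :=
  if tau y - x != x then Some (tau y - x, i)
  else if y == x then Some (x, i - 1) else None.

Definition skolem_op (p q : point) : point :=
  match p, q with
  | None, None => None
  | None, Some (x, i) | Some (x, i), None => skolem_inf x i
  | Some (x, i), Some (y, j) =>
      if i == j then if x == y then Some (x, i) else Some (sigma (x + y), i + 1)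
      else if j == i + 1 then skolem_up x i y else skolem_up y j x
  end.

Lemma skolem_steiner : steiner_op skolem_op.
Proof.
have De (x : R) : (x + e) + (x + e) = x + x by rewrite addrACA ee addr0.
have ne (x : R) : ((x + e == x) = false) * ((x == x + e) = false).
  have h : (x + e == x) = false by rewrite -subr_eq0 addrC addKr (negPf e_neq0).
  by rewrite [x == _]eq_sym h.
have eK (x : R) : x + e + e = x by rewrite -addrA ee addr0.
have Ne : - e = e by apply/eqP; rewrite eq_sym -addr_eq0 ee.
have DeN x : (sigma (x + x) == x + e) = (sigma (x + x) != x).
  case: (sigma_double x) => ->; rewrite eqxx ne //.
split.
- by case=> [[x i]|] //=; rewrite !eqxx.
- move=> [[x i]|] [[y j]|] //=.
  rewrite (eq_sym y) (addrC y).
  have [-> | -> | ->] := Z3P i j; rewrite ?eqxx ?Z3E ?Z3E ?subrK ?eqxx //.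
  by case: eqP => [->|].
move=> [[x i]|] [[y j]|] //=.
- have [-> | -> | ->] := Z3P i j; rewrite ?eqxx ?Z3E ?Z3E.
  + case: (eqVneq x y) => [->|xy]; first by rewrite /= !eqxx.
    rewrite /= Z3E eqxx /skolem_up sigmaK [x + y]addrC addrK eq_sym xy //.
  + rewrite /skolem_up; case: (eqVneq (tau y - x) x) => [ty|ty] /=.
      have sy : sigma (x + x) = y by rewrite -{1}ty subrK tauK.
      case: (eqVneq y x) => [yx|yx] /=.
        by rewrite !Z3E /skolem_up -{1}yx ty eqxx /= yx.
      rewrite /skolem_inf sy (negPf yx); congr (Some (_, _)).
      by case: (sigma_double x); rewrite sy // => yx'; rewrite yx' eqxx in yx.
    by rewrite eqxx eq_sym (negPf ty) addrC subrK tauK.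
  + rewrite /skolem_up; case: (eqVneq (tau x - y) y) => [ty|ty] /=.
      have sx : sigma (y + y) = x by rewrite -{1}ty subrK tauK.
      case: (eqVneq x y) => [xy|xy] /=.
        by rewrite Z3E Z3E eqxx; move: ty; rewrite xy => ->; rewrite !eqxx.
      have xye : x = y + e.
        by case: (sigma_double y); rewrite sx // => xy'; rewrite xy' eqxx in xy.
      by rewrite /skolem_inf xye De sx xye eqxx eK.
    rewrite !Z3E /skolem_up opprB [tau x + _]addrCA subrr addr0.
    by rewrite eq_sym ty.
- rewrite /skolem_inf; case: (eqVneq (sigma (x + x)) x) => [Dx|Dx] /=.
    have tx : tau x = x + x by rewrite -{1}Dx sigmaK.
    by rewrite !Z3E /skolem_up tx opprD Ne addrA addrK eqxx /= ne.
  have txe : tau (x + e) = x + x.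
    by case: (sigma_double x) Dx => [->|<-]; rewrite ?eqxx ?sigmaK.
  by rewrite Z3E eqxx /skolem_up txe addrK eqxx /= ne.
rewrite /skolem_inf; case: (eqVneq (sigma (y + y)) y) => [Dy|Dy] /=.
  by rewrite /skolem_inf De Dy ne eK subrK.
by rewrite /skolem_inf De DeN Dy eK addrK.
Qed.
End Skolem.

Section Doubling.
Variables (V : eqType) (op : V -> V -> V).
Hypothesis sop : steiner_op op.

(** The doubling [v -> 2 v + 1]: copies [a], [b] of two points go to copy
[a (+) b] of the third, and [None] joins the two copies of each point.  Copy
[false] is a subsystem, so it keeps its Pasch configurations. *)
Definition double_op (p q : option (bool * V)) : option (bool * V) :=
  match p, q with
  | None, None => None
  | None, Some (a, x) | Some (a, x), None => Some (~~ a, x)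
  | Some (a, x), Some (b, y) =>
      if x == y then if a == b then Some (a, x) else None
      else Some (a (+) b, op x y)
  end.

Lemma double_steiner : steiner_op double_op.
Proof.
have [opI opC opK] := sop; split.
- by move=> [[a x]|] //=; rewrite !eqxx.
- move=> [[a x]|] [[b y]|] //=; rewrite (eq_sym y) (eq_sym b) addbC opC.
  by case: eqP => [->|//]; case: eqP => [->|].
move=> [[a x]|] [[b y]|] //=; last by rewrite negbK.
- case: (eqVneq x y) => [->|xy].
    case: (eqVneq a b) => [->|ab] /=; first by rewrite !eqxx.
    by move: ab; case: a; case: b.
  have /= := steiner_op_neq sop xy; rewrite !inE negb_or.
  case/andP => /andP[_ /negPf xz] _; rewrite xz.
  by rewrite addKb opK.
- by rewrite eqxx; case: a.
Qed.
End Doubling.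

Lemma double_grid (V : eqType) u : pasch_grid V u ->
  pasch_grid (option (bool * V)) u.
Proof.
case=> op lab X X' Y Y' sop nX nY lX lX' lY lY' lZ lZ' eZ eZ'.
pose lab' (p : option (bool * V)) := if p is Some (_, x) then lab x else 0.
have XY (k l : 'I_u) (x y : V) : lab x = k -> lab y = u + l -> (x == y) = false.
  move=> lx ly; apply/eqP => e; move: lx; rewrite e ly.
  by have := ltn_ord k; lia.
pose j (W : 'I_u -> V) := fun k => Some (false, W k).
apply: (@PaschGrid _ _ (double_op op) lab' (j X) (j X') (j Y) (j Y'))
  => //=; try by [exact: double_steiner | move=> k []; exact: nX
                 | move=> l []; exact: nY].
all: by move=> k l; rewrite ?(XY k l) //= ?lZ ?lZ' ?eZ ?eZ'.
Qed.

(** The configurations use points on level 0 with [x < u] and [u <= x < 2 * u];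
[X], [X'] and [Y], [Y'] are the two copies. *)
Lemma bose_grid u : pasch_grid ('Z_3 + (bool * 'I_u.*2.+1 * 'Z_3)) u.
Proof.
pose R : zmodType := 'I_u.*2.+1.
pose half (x : R) : R := (x *+ u.+1)%R.
have hh (x : R) : (half x + half x)%R = x.
  rewrite /half -mulrnDr; have -> : u.+1 + u.+1 = u.*2.+2 by lia.
  rewrite mulrS Zp_mulrn; have -> : inZp (x * u.*2.+1) = 0%R :> R.
    by apply: val_inj; rewrite /= modnMl.
  by rewrite addr0.
have hd (x : R) : half (x + x)%R = x by rewrite /half mulrnDl hh.
pose pt (a : bool) (x : nat) : 'Z_3 + (bool * R * 'Z_3) := inr (a, inord x, 0%R).
pose lab (p : 'Z_3 + (bool * 'I_u.*2.+1 * 'Z_3)) : nat :=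
  if p is inr (_, x, i) then if i == 0%R then val x else 2 * u else 0.
have inordE m (x : 'I_u) : m <= u -> (inord (m + x) : 'I_u.*2.+1) = m + x :> nat.
  by move=> mu; rewrite inordK //; have := ltn_ord x; lia.
have XY (k l : 'I_u) : (inord (0 + k) == inord (u + l) :> R) = false.
  by rewrite -val_eqE /= !inordE //; have := ltn_ord k; lia.
apply: (@PaschGrid _ _ (bose_op half) lab
  (fun k => pt false (0 + k)) (fun k => pt true (0 + k))
  (fun l => pt false (u + l)) (fun l => pt true (u + l))) => //=.
- exact: bose_steiner.
- by move=> k; rewrite inordE.
- by move=> k; rewrite inordE.
- by move=> k; rewrite inordE.
- by move=> k; rewrite inordE.
all: by move=> k l; rewrite XY.
Qed.

(** The order of the group is even, and adding [e] to both summands does not change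
the sum, whence the Pasch configurations on [x], [x + e], [y], [y + e].  The map
[sigma] halves the even elements [x + x], and puts the odd ones in the other
half of the group. *)
Lemma skolem_grid t u : 2 * u <= t.+1 ->
  pasch_grid (option ('I_t.*2.+2 * 'Z_3)) u.
Proof.
move=> ut; pose R : zmodType := 'I_t.*2.+2.
pose sigma (x : R) : R := inord (if odd x then t.+1 + x./2 else x./2).
pose tau (y : R) : R := inord (if y < t.+1 then y.*2 else (y - t.+1).*2.+1).
pose e : R := inord t.+1.
have ve : val e = t.+1 by rewrite /= inordK //; lia.
have vs (x : R) : val (sigma x) =
    if odd (val x) then t.+1 + (val x)./2 else (val x)./2.
  rewrite /sigma /= inordK //; have := ltn_ord x; have := odd_double_half x.
  by case: (odd x) => /=; lia.
have vt (y : R) : val (tau y) =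
    if val y < t.+1 then (val y).*2 else (val y - t.+1).*2.+1.
  by rewrite /tau /= inordK //; have := ltn_ord y; case: (ltnP y t.+1) => /=; lia.
have vD (x y : R) : val (x + y)%R =
   if val x + val y < t.*2.+2 then val x + val y else val x + val y - t.*2.+2.
  rewrite /=; case: ltnP => [h|h]; first by rewrite modn_small.
  rewrite -[in LHS](subnK h) modnDr modn_small //.
  by have := ltn_ord x; have := ltn_ord y; lia.
have sK : cancel sigma tau.
  move=> x; apply: val_inj; rewrite vt vs.
  have := ltn_ord x; have := odd_double_half x; rewrite /=.
  by case: (odd x) => /=; [case: (ltnP (t.+1 + x./2))|case: (ltnP x./2)] => /=; lia.
have tK : cancel tau sigma.
  move=> x; apply: val_inj; rewrite vs vt.
  have := ltn_ord x; case: (ltnP x t.+1) => /= h h'; first by rewrite odd_double doubleK.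
  by rewrite odd_double /= uphalf_double; lia.
have e0 : (e != 0)%R by rewrite -val_eqE ve.
have ee : (e + e = 0)%R by apply: val_inj; rewrite vD ve /=; case: ltnP; lia.
have sd (x : R) : sigma (x + x)%R = x \/ sigma (x + x)%R = (x + e)%R.
  have lx := ltn_ord x; case: (ltnP (val x) t.+1) => h; [left|right].
    have vxx : val (x + x)%R = (val x).*2 by rewrite vD ifT; lia.
    by apply: val_inj; rewrite vs vxx odd_double doubleK.
  have vxx : val (x + x)%R = (val x - t.+1).*2 by rewrite vD ifF; lia.
  have vxe : val (x + e)%R = val x - t.+1 by rewrite vD ve ifF; lia.
  by apply: val_inj; rewrite vs vxx vxe odd_double doubleK.
pose pt (b : bool) (x : nat) : option (R * 'Z_3) :=
  Some (if b then (inord x + e)%R else inord x, 0%R).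
pose lab (p : option ('I_t.*2.+2 * 'Z_3)) : nat :=
  if p is Some (x, i) then if i == 0%R then x %% t.+1 else 2 * u else 0.
have inE' m : m < t.+1 -> val (inord m : R) = m by move=> h; rewrite /= inordK //; lia.
have labE b m : m < t.+1 -> lab (pt b m) = m.
  move=> h; rewrite /lab /pt eqxx; case: b; last by rewrite inE' // modn_small.
  by rewrite vD ve inE' // ifT ?modnDr ?modn_small //; lia.
have lt1 (k : 'I_u) : k < t.+1 by have := ltn_ord k; lia.
have lt2 (k : 'I_u) : u + k < t.+1 by have := ltn_ord k; lia.
have XY (k l : 'I_u) b c : pt b k = pt c (u + l) -> False.
  move/(congr1 lab); rewrite !labE //; have := ltn_ord k; lia.
have XYe (k l : 'I_u) b c :
  ((if b then inord k + e else inord k) == (if c then inord (u + l) + e else inord (u + l)) :> R)%R = false.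
  by apply/eqP => E; apply: (@XY k l b c); rewrite /pt E.
apply: (@PaschGrid _ _ (skolem_op sigma tau e) lab
  (fun k => pt false k) (fun k => pt true k)
  (fun l => pt false (u + l)) (fun l => pt true (u + l))).
- exact: skolem_steiner.
- move=> k [] /eqP; rewrite -subr_eq0 opprD addrA subrr sub0r oppr_eq0.
  by rewrite (negPf e0).
- move=> k [] /eqP; rewrite -subr_eq0 opprD addrA subrr sub0r oppr_eq0.
  by rewrite (negPf e0).
- by move=> k; rewrite labE.
- by move=> k; rewrite labE.
- by move=> k; rewrite labE.
- by move=> k; rewrite labE.
- by move=> k l; rewrite /= (XYe k l false false).
- by move=> k l; rewrite /= (XYe k l false true).
- move=> k l; rewrite /= (XYe k l false false) (XYe k l true true).
  by rewrite addrACA ee addr0.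
- move=> k l; rewrite /= (XYe k l true false) (XYe k l false true).
  by rewrite addrAC addrA.
Qed.

Lemma grid_rich_ord (V : finType) n u : #|V| = n -> pasch_grid V u ->
  pasch_rich 'I_n (u * u).
Proof.
by move=> <- /pasch_grid_rich; apply: pasch_rich_bij (@enum_rank_bij V).
Qed.

Lemma exists_pasch_rich n : 100 <= n ->
  n = 1 %[mod 6] \/ n = 3 %[mod 6] ->
  exists2 m, pasch_rich 'I_n m & n ^ 2 <= 1000 * m.
Proof.
move=> n100 n6; rewrite -mulnn.
have Z3_card : #|'Z_3| = 3 by rewrite card_ord.
have skolem_card s : 0 < s -> #|{: option ('I_s.-1.*2.+2 * 'Z_3)}| = 6 * s + 1.
  by move=> s0; rewrite card_option card_prod Z3_card card_ord; lia.
have sq u : n <= 31 * u -> n * n <= 1000 * (u * u) by nia.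
have [n1|n1] : n %% 6 = 1 \/ n %% 6 = 3 by case: n6 => ->; [left|right].
- exists (n %/ 12 * (n %/ 12)); last by apply: sq; lia.
  apply: grid_rich_ord (skolem_grid (t := (n %/ 6).-1) _); last by lia.
  by rewrite skolem_card; lia.
have [n2|n2] : n %% 12 = 3 \/ n %% 12 = 9 by lia.
- exists (n %/ 24 * (n %/ 24)); last by apply: sq; lia.
  apply: grid_rich_ord (double_grid (skolem_grid (t := (n %/ 12).-1) _)).
    rewrite card_option card_prod card_bool skolem_card; lia.
  by lia.
exists (n %/ 12 * (n %/ 12)); last by apply: sq; lia.
apply: grid_rich_ord (bose_grid _).
by rewrite card_sum !card_prod card_bool Z3_card card_ord; lia.
Qed.

(** * Ramsey's theorem for triples *)

(** [H x b s] is read: the link of [x] in [s] has colour [b].  Iterating [chain]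
turns homogeneity of a list of points into that of pairs and of triples. *)
Fixpoint chain (T : Type) (H : T -> bool -> seq T -> bool) (b : bool) (s : seq T) :=
  if s is x :: s' then H x b s' && chain H b s' else true.

Fixpoint chain_bound (r : nat -> nat) (k : nat) : nat :=
  if k is k'.+1 then (r (chain_bound r k')).+1 else 0.

Lemma chain_subseq (T : eqType) (H : T -> bool -> seq T -> bool) b s s' :
  (forall x s s', subseq s' s -> H x b s -> H x b s') ->
  subseq s' s -> chain H b s -> chain H b s'.
Proof.
move=> hH; elim: s s' => [|x s IH] [|y s'] //= sub /andP[Hx Cs].
move: sub; case: eqP => [-> sub|_ sub]; last exact: (IH (y :: s')).
by rewrite (hH _ _ _ sub Hx) IH.
Qed.

(** One step of the Erdos-Rado argument: pass to homogeneous links again and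
again; every point left behind records the colour of its link, and by induction
on [m0 + m1] one of the two colours is recorded often enough. *)
Lemma chain_ramsey (T : eqType) (H : T -> bool -> seq T -> bool) (r : nat -> nat) :
  (forall b x s s', subseq s' s -> H x b s -> H x b s') ->
  (forall m x s, r m <= size s ->
     exists b s', [/\ subseq s' s, m <= size s' & H x b s']) ->
  forall k m0 m1 s, m0 + m1 <= k -> chain_bound r k <= size s ->
  exists b s', [/\ subseq s' s, size s' = (if b then m1 else m0) & chain H b s'].
Proof.
move=> hH rH; elim=> [|k IH] m0 m1 s mk sz.
  by exists true, [::]; rewrite sub0seq /=; split=> //; lia.
case: m0 mk => [|m0] mk; first by exists false, [::]; rewrite sub0seq.
case: m1 mk => [|m1] mk; first by exists true, [::]; rewrite sub0seq.
case: s sz => [|x s] //= sz; have [b [t [ts st Ht]]] := rH _ x s sz.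
have [|c [u [ut su Cu]]] :=
  IH (if b then m0.+1 else m0) (if b then m1 else m1.+1) t _ st; first by case: b {Ht}; lia.
have us := subseq_trans ut ts.
have [bc|bc] := eqVneq b c.
  exists b, (x :: u); rewrite /= eqxx bc Cu (hH _ _ _ _ ut) -?bc //.
  by split=> //; rewrite su -bc; case: (b).
exists c, u; split=> //; first exact: subseq_trans us (subseq_cons s x).
by rewrite su; case: b c bc {Ht Cu su} => [] [].
Qed.

Definition link1 (T : eqType) (g : T -> bool) (b : bool) (s : seq T) :=
  all (fun y => g y == b) s.

Definition link2 (T : eqType) (g : T -> T -> bool) (b : bool) (s : seq T) :=
  chain (fun x => link1 (g x)) b s.

Definition link3 (T : eqType) (f : T -> T -> T -> bool) (b : bool) (s : seq T) :=
  chain (fun x => link2 (f x)) b s.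

Lemma link1_subseq (T : eqType) (g : T -> bool) b s s' :
  subseq s' s -> link1 g b s -> link1 g b s'.
Proof. by move=> /mem_subseq sub /allP ga; apply/allP => y /sub/ga. Qed.

Lemma link1_ramsey (T : eqType) (g : T -> bool) m s : 2 * m <= size s ->
  exists b s', [/\ subseq s' s, m <= size s' & link1 g b s'].
Proof.
move=> sz; have [mc|mc] := leqP m (count g s).
  exists true, (filter g s); rewrite filter_subseq size_filter; split=> //.
  by apply/allP => y; rewrite mem_filter => /andP[->].
exists false, (filter (predC g) s); rewrite filter_subseq size_filter.
split=> //; first by have := count_predC g s; lia.
by apply/allP => y; rewrite mem_filter => /andP[/negPf/= ->].
Qed.

Definition ramsey2_bound (m : nat) := chain_bound (muln 2) (m + m).

Lemma link2_ramsey (T : eqType) (g : T -> T -> bool) m s :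
  ramsey2_bound m <= size s ->
  exists b s', [/\ subseq s' s, m <= size s' & link2 g b s'].
Proof.
move=> sz.
have [b x t t'||b [t [ts st Ct]]] := @chain_ramsey T (fun x => link1 (g x)) (muln 2) _ _ _ m m s (leqnn _) sz.
- exact: link1_subseq.
- by move=> k x t; apply: link1_ramsey.
by exists b, t; split; rewrite // st; case: (b).
Qed.

Lemma link3_ramsey m : exists N, forall (T : eqType) (f : T -> T -> T -> bool) s,
  N <= size s -> exists b s', [/\ subseq s' s, size s' = m & link3 f b s'].
Proof.
exists (chain_bound ramsey2_bound (m + m)) => T f s sz.
have [b x t t' tt'||b [t [ts st Ct]]] :=
  @chain_ramsey T (fun x => link2 (f x)) ramsey2_bound _ _ _ m m s (leqnn _) sz.
- by apply: chain_subseq tt' => y u u'; apply: link1_subseq.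
- by move=> k x t; apply: link2_ramsey.
by exists b, t; split; rewrite // st; case: (b).
Qed.

Lemma link2_sym (T : eqType) (g : T -> T -> bool) b s : symmetric g ->
  link2 g b s -> {in s &, forall x y, x != y -> g x y = b}.
Proof.
move=> gC; elim: s => [|w s IH] //= /andP[/allP Hw Cs] x y.
rewrite !inE => /predU1P[->|xs] /predU1P[->|ys]; rewrite ?eqxx // => xy.
- by apply/eqP/Hw.
- by rewrite gC; apply/eqP/Hw.
- exact: IH.
Qed.

Lemma link3_sym (T : eqType) (f : T -> T -> T -> bool) b s :
  (forall x y z, f x y z = f y x z) -> (forall x y z, f x y z = f x z y) ->
  link3 f b s -> {in s & &, forall x y z, uniq [:: x; y; z] -> f x y z = b}.
Proof.
move=> f12 f23; elim: s => [|w s IH] //= /andP[Hw Cs] x y z.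
have W y' z' : y' \in s -> z' \in s -> y' != z' -> f w y' z' = b.
  by move=> ys zs; apply: (link2_sym _ Hw) => //; apply: f23.
rewrite !inE negb_or andbT.
move=> /predU1P[->|xs] /predU1P[->|ys] /predU1P[->|zs]; rewrite ?eqxx ?andbF //=.
- by move=> /andP[_ yz]; apply: W.
- by move=> /andP[/andP[_ xz] _]; rewrite f12; apply: W.
- by move=> /andP[/andP[xy _] _]; rewrite f23 f12; apply: W.
- by move=> u; apply: IH; rewrite //= !inE negb_or andbT.
Qed.

(** * Colourings with balanced octahedra over a homogeneous base *)

Definition perfect (T : finType) (c : pred {set T}) (w : seq T) : bool :=
  [forall s : 6.-tuple T, uniq s && all (mem w) s ==> ~~ unbalanced c s].

Lemma perfect_octahedron (T : finType) (c : pred {set T}) w x x' y y' z z' :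
  perfect c w -> uniq [:: x; x'; y; y'; z; z'] ->
  all (mem w) [:: x; x'; y; y'; z; z'] ->
  c (tri x y z) + c (tri x y' z') + c (tri x' y z') + c (tri x' y' z) =
  c (tri x' y' z') + c (tri x' y z) + c (tri x y' z) + c (tri x y z').
Proof.
move=> /forallP/(_ [tuple x; x'; y; y'; z; z'])/implyP imp us ws.
have := imp; rewrite us ws => /(_ isT) /negPn/eqP /=.
by rewrite !addnA !addn0.
Qed.

Lemma perfect_sub (T : finType) (c : pred {set T}) w w' :
  {subset w' <= w} -> perfect c w -> perfect c w'.
Proof.
move=> sub /forallP pw; apply/forallP => s; apply/implyP => /andP[us /allP ws].
by apply: (implyP (pw s)); rewrite us; apply/allP => x /ws/sub.
Qed.

(** [distinct_facts] breaks up the distinctness of listed points, and [distinct]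
proves such statements from the pieces in either orientation. *)
Ltac distinct_facts :=
  rewrite /= ?inE ?negb_or -?andbA;
  repeat (case/andP; let h := fresh "neq" in move=> h);
  let h := fresh "neq" in move=> h.
Ltac distinct :=
  rewrite /= ?inE ?negb_or ?andbT; do ?[apply/andP; split];
  first [done | by rewrite eq_sym].

Lemma mem_avoid (T : eqType) (B l : seq T) : uniq B -> size l < size B ->
  exists2 b, b \in B & b \notin l.
Proof.
move=> uB lB; apply/hasP; rewrite has_predC; apply: contraL lB => /allP sub.
by rewrite -leqNgt; apply: uniq_leq_size.
Qed.

Section HomogeneousBase.
Variables (T : finType) (c : pred {set T}) (B : seq T).
Hypothesis uB : uniq B.
Hypothesis sB : size B = 6.
Local Notation f x y z := (c (tri x y z)).
Hypothesis B0 : {in B & &, forall x y z, uniq [:: x; y; z] -> f x y z = false}.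

Definition has_profile (p : T) (bs : T * bool) : bool :=
  (bs.1 \in B) && [forall b in B, forall b' in B,
    [&& b != bs.1, b' != bs.1 & b != b'] ==> (f p b b' == bs.2)].

(** Apply balancedness to the octahedron [p b, u w, v x] with a sixth point [b] of
the base: all faces containing [b] have colour 0. *)
Lemma link_four_cycle p u v w x : p \notin B -> perfect c (p :: B) ->
  u \in B -> v \in B -> w \in B -> x \in B -> uniq [:: u; v; w; x] ->
  f p u v + f p w x = f p u x + f p w v.
Proof.
move=> pB perf uB' vB wB xB dist.
have [|b bB] := @mem_avoid _ B [:: u; v; w; x] uB; first by rewrite sB.
have N a : a \in B -> p != a by move=> aB; apply: contraNneq pB => ->.
have [pu pv pw px pb] := And5 (N u uB') (N v vB) (N w wB) (N x xB) (N b bB).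
move: dist; distinct_facts; distinct_facts.
have := @perfect_octahedron _ c _ p b u w v x perf.
have -> : uniq [:: p; b; u; w; v; x] by distinct.
have -> : all (mem (p :: B)) [:: p; b; u; w; v; x].
  by rewrite /= !inE eqxx uB' vB wB xB bB !orbT.
move=> /(_ isT isT).
have -> : f b u x = false by apply: B0; rewrite //; distinct.
have -> : f b w v = false by apply: B0; rewrite //; distinct.
have -> : f b w x = false by apply: B0; rewrite //; distinct.
have -> : f b u v = false by apply: B0; rewrite //; distinct.
by rewrite /= !addn0 !add0n => ->; rewrite addnC.
Qed.

(** By the four-cycle relation the link of [p] in [B] is constant, or a star
added to or removed from a constant graph; so one point of [B] can be dropped to
make it constant. *)
Lemma profile_exists p : p \notin B -> perfect c (p :: B) ->
  exists bs, has_profile p bs.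
Proof.
move=> pB perf; have [g gE] : {g | forall b b', f p b b' = g b b'} by exists (fun b b' => f p b b').
have gC b b' : g b b' = g b' b by rewrite -!gE tri_perm23.
have cyc u v w x : u \in B -> v \in B -> w \in B -> x \in B ->
    uniq [:: u; v; w; x] -> g u v + g w x = g u x + g w v.
  by rewrite -!gE; apply: link_four_cycle.
have prof b0 s : b0 \in B -> (forall b b', b \in B -> b' \in B ->
    b != b0 -> b' != b0 -> b != b' -> g b b' = s) -> exists bs, has_profile p bs.
  move=> b0B gs; exists (b0, s); rewrite /has_profile b0B /=.
  apply/forallP => b; apply/implyP => bB; apply/forallP => b'; apply/implyP => bB'.
  by apply/implyP => /and3P[*]; rewrite gE; apply/eqP/gs.
have [a aB _] : exists2 a, a \in B & a \notin [::] by apply: mem_avoid; rewrite ?sB.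
(* The second case has two edges with a common end and different colours. *)
case: (boolP [exists b1 in B, exists b2 in B, exists b in B,
    [&& uniq [:: b1; b2; b], g b1 b & ~~ g b2 b]]) => [|/existsPn const]; last first.
  have star b1 b2 b : b1 \in B -> b2 \in B -> b \in B -> b1 != b2 -> b1 != b ->
      b2 != b -> g b1 b = g b2 b.
    have half x y : x \in B -> y \in B -> b \in B -> x != y -> x != b ->
        y != b -> g x b -> g y b.
      move=> xB yB bB xy xb yb gb; have := const x; apply: contraNT => ngb.
      rewrite xB; apply/existsP; exists y; rewrite yB; apply/existsP; exists b.
      by rewrite bB gb ngb /= !inE negb_or xy xb yb.
    move=> b1B b2B bB b12 b1b b2b; apply/idP/idP; apply: half => //.
    by rewrite eq_sym.
  have [|a' a'B] := @mem_avoid _ B [:: a] uB; first by rewrite sB.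
  rewrite inE => a'a; apply: (prof a (g a a')) => // b b' bB b'B ba b'a bb'.
  rewrite (star b a b') // 1?eq_sym //.
  have [->//|b'a'] := eqVneq b' a'.
  by rewrite gC (gC a) (star b' a' a).
case/existsP=> b1 /andP[b1B /existsP[b2 /andP[b2B /existsP[b /andP[bB]]]]].
case/and3P; distinct_facts; move=> g1 g2.
have G x : x \in B -> x != b1 -> x != b2 -> g b1 x /\ g b2 x = false.
  move=> xB x1 x2; have [->|xb] := eqVneq x b; first by rewrite g1 (negPf g2).
  have := cyc b1 b b2 x b1B bB b2B xB.
  have -> : uniq [:: b1; b; b2; x] by distinct.
  by move=> /(_ isT); rewrite g1 (negPf g2); case: (g b1 x); case: (g b2 x).
have star x y z : x \in B -> y \in B -> z \in B ->
    x != b1 -> x != b2 -> y != b1 -> y != b2 -> z != b1 -> z != b2 ->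
    x != y -> x != z -> y != z -> g y z = g y x.
  move=> xB yB zB x1 x2 y1 y2 z1 z2 xy xz yz.
  have [gx _] := G x xB x1 x2; have [gz _] := G z zB z1 z2.
  have := cyc b1 x y z b1B xB yB zB.
  have -> : uniq [:: b1; x; y; z] by distinct.
  by rewrite gx gz => /(_ isT); case: (g y z); case: (g y x).
have [|y0 y0B] := @mem_avoid _ B [:: b1; b2] uB; first by rewrite sB.
have [|y1 y1B] := @mem_avoid _ B [:: b1; b2; y0] uB; first by rewrite sB.
rewrite !inE !negb_or => /and3P[y11 y12 y10] /andP[y01 y02].
have K y z : y \in B -> z \in B -> y != b1 -> y != b2 -> z != b1 -> z != b2 ->
    y != z -> g y z = g y0 y1.
  move=> yB zB ny1 ny2 z1 z2 yz; have [yy0|yy0] := eqVneq y y0.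
    have [zy1|zy1] := eqVneq z y1; first by rewrite yy0 zy1.
    by rewrite yy0 in yz *; apply: star => //; rewrite eq_sym.
  have -> : g y z = g y0 y.
    rewrite gC [RHS]gC gC; have [->//|zy0] := eqVneq z y0.
    by apply: star => //; rewrite eq_sym.
  have [->//|yy1] := eqVneq y y1.
  by apply: star => //; rewrite eq_sym.
case gam: (g y0 y1).
  apply: (prof b2 true) => // b' b'' b'B b''B b'2 b''2 b'b''.
  have [e|b'1] := eqVneq b' b1.
    by rewrite e; have [] := G b'' b''B _ b''2; rewrite // -e eq_sym.
  have [e|b''1] := eqVneq b'' b1.
    by rewrite e gC; have [] := G b' b'B _ b'2.
  by rewrite K.
apply: (prof b1 false) => // b' b'' b'B b''B b'1 b''1 b'b''.
have [e|b'2] := eqVneq b' b2.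
  by rewrite e; have [] := G b'' b''B b''1 _; rewrite // -e eq_sym.
have [e|b''2] := eqVneq b'' b2.
  by rewrite e gC; have [] := G b' b'B b'1 _.
by rewrite K.
Qed.

(** [exc p] is the point of the base that is dropped, [side p] the colour of the
rest of the link, and [joint p q] the common colour of the triples [p, q, b] for
all other [b]. *)
Definition profile (p : T) : T * bool :=
  odflt (p, false) [pick bs | has_profile p bs].
Definition exc (p : T) := (profile p).1.
Definition side (p : T) := (profile p).2.
Definition joint (p q : T) : bool :=
  f p q (odflt p [pick b in B | b \notin [:: exc p; exc q]]).

Lemma joint_sym p q : joint p q = joint q p.
Proof.
rewrite /joint; have e : [pick b in B | b \notin [:: exc p; exc q]] =
    [pick b in B | b \notin [:: exc q; exc p]].
  by apply: eq_pick => b; rewrite !inE orbC.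
rewrite e; case: pickP => [b _|no] /=; first exact: congr1 (tri_perm12 _ _ _).
have [|b bB bn] := @mem_avoid _ B [:: exc q; exc p] uB; first by rewrite sB.
by have := no b; rewrite /= bB bn.
Qed.

Lemma sideE p b b' : p \notin B -> perfect c (p :: B) -> b \in B -> b' \in B ->
  b != exc p -> b' != exc p -> b != b' -> f p b b' = side p.
Proof.
move=> pB perf bB b'B be b'e bb'; move: be b'e; rewrite /exc /side /profile.
case: pickP => [bs /andP[_ /forallP h]|no] /=; last first.
  by have [bs] := profile_exists pB perf; rewrite no.
move=> be b'e; apply/eqP; have := h b.
by rewrite bB => /forallP/(_ b'); rewrite b'B be b'e bb'.
Qed.

Definition generic (p q r : T) : bool :=
  uniq [:: p, q, r & B] && perfect c [:: p, q, r & B].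

Lemma generic_perm12 p q r : generic p q r -> generic q p r.
Proof.
case/andP=> u perf; apply/andP; split; last first.
  by apply: perfect_sub perf => x; rewrite !inE orbCA.
move: u; rewrite /= !inE !negb_or (eq_sym q p) -!andbA.
by case/and5P=> -> -> -> -> /and3P[-> -> ->].
Qed.

Lemma generic_perm23 p q r : generic p q r -> generic p r q.
Proof.
case/andP=> u perf; apply/andP; split; last first.
  by apply: perfect_sub perf => x; rewrite !inE => /or4P[] ->; rewrite ?orbT.
move: u; rewrite /= !inE !negb_or (eq_sym r q) -!andbA.
by case/and5P=> -> -> -> -> /and3P[-> -> ->].
Qed.

Lemma generic_side p q r b b' : generic p q r -> b \in B -> b' \in B ->
  b != exc p -> b' != exc p -> b != b' -> f p b b' = side p.
Proof.
case/andP=> /= /and3P[pB _ _] perf; apply: sideE.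
  by move: pB; rewrite !inE !negb_or => /and3P[].
by apply: perfect_sub perf => x; rewrite !inE => /orP[->|->]; rewrite ?orbT.
Qed.

(** Two admissible base points [b], [b'] give the same colour, by the octahedron
[p b1, q b2, b b'] with two further admissible points [b1], [b2]; the base has
six points because at most two of them are dropped here. *)
Lemma generic_joint p q r b : generic p q r -> b \in B -> b != exc p ->
  b != exc q -> f p q b = joint p q.
Proof.
move=> gen bB bp bq; rewrite /joint; case: pickP => [b' /andP[b'B]|no] /=; last first.
  by have := no b; rewrite /= bB !inE negb_or bp bq.
rewrite !inE negb_or => /andP[b'p b'q].
have [->//|bb'] := eqVneq b b'.
have [|b1 b1B] := @mem_avoid _ B [:: b; b'; exc p; exc q] uB; first by rewrite sB.
have [|b2 b2B] := @mem_avoid _ B [:: b1; b; b'; exc p; exc q] uB; first by rewrite sB.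
rewrite !inE !negb_or => /and5P[b21 b2b b2b' b2p b2q] /and4P[b1b b1b' b1p b1q].
have /andP[/= /and3P[pqr qr _] perf] := gen.
move: pqr qr; rewrite !inE !negb_or => /and3P[pq _ pB] /andP[_ qB].
have N a x : a \in B -> x \notin B -> x != a by move=> aB; apply: contraNneq => ->.
have [pb pb' pb1 pb2] := And4 (N b p bB pB) (N b' p b'B pB) (N b1 p b1B pB) (N b2 p b2B pB).
have [qb qb' qb1 qb2] := And4 (N b q bB qB) (N b' q b'B qB) (N b1 q b1B qB) (N b2 q b2B qB).
have := @perfect_octahedron _ c _ p b1 q b2 b b' perf.
have -> : uniq [:: p; b1; q; b2; b; b'] by distinct.
have -> : all (mem [:: p, q, r & B]) [:: p; b1; q; b2; b; b'].
  by rewrite /= !inE !eqxx bB b'B b1B b2B !orbT.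
have gen' := generic_perm12 gen.
rewrite (tri_perm12 b1 q) (tri_perm12 b1 q).
rewrite (generic_side gen (b := b2) (b' := b')) //.
rewrite (generic_side gen (b := b2) (b' := b)) //.
rewrite (generic_side gen' (b := b1) (b' := b')) //.
rewrite (generic_side gen' (b := b1) (b' := b)) //.
have -> : f b1 b2 b = false by apply: B0; rewrite //; distinct.
have -> : f b1 b2 b' = false by apply: B0; rewrite //; distinct.
move=> /(_ isT isT); case: (f p q b); case: (f p q b'); case: (side p); case: (side q) => //.
Qed.

(** The octahedron [p b1, q b2, r b3] with base points outside the three dropped
ones. *)
Lemma generic_sum p q r : generic p q r ->
  f p q r + side p + side q + side r = joint p q + joint p r + joint q r.
Proof.
move=> gen.
have [|b1 b1B] := @mem_avoid _ B [:: exc p; exc q; exc r] uB; first by rewrite sB.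
have [|b2 b2B] := @mem_avoid _ B [:: b1; exc p; exc q; exc r] uB; first by rewrite sB.
have [|b3 b3B] := @mem_avoid _ B [:: b1; b2; exc p; exc q; exc r] uB; first by rewrite sB.
rewrite !inE !negb_or => /and5P[b31 b32 b3p b3q b3r] /and4P[b21 b2p b2q b2r].
move=> /and3P[b1p b1q b1r].
have /andP[/= /and4P[pqr qr rB _] perf] := gen.
move: pqr qr; rewrite !inE !negb_or => /and3P[pq pr pB] /andP[qr qB].
have N a x : a \in B -> x \notin B -> x != a by move=> aB; apply: contraNneq => ->.
have [pb1 pb2 pb3] := And3 (N b1 p b1B pB) (N b2 p b2B pB) (N b3 p b3B pB).
have [qb1 qb2 qb3] := And3 (N b1 q b1B qB) (N b2 q b2B qB) (N b3 q b3B qB).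
have [rb1 rb2 rb3] := And3 (N b1 r b1B rB) (N b2 r b2B rB) (N b3 r b3B rB).
have := @perfect_octahedron _ c _ p b1 q b2 r b3 perf.
have -> : uniq [:: p; b1; q; b2; r; b3] by distinct.
have -> : all (mem [:: p, q, r & B]) [:: p; b1; q; b2; r; b3].
  by rewrite /= !inE !eqxx b1B b2B b3B !orbT.
have gen_q := generic_perm12 gen.
have gen_r := generic_perm12 (generic_perm23 gen).
have gen_pr := generic_perm23 gen.
have gen_qr := generic_perm23 gen_q.
rewrite (tri_perm12 b1 q b3) (tri_perm23 b1 b2 r) (tri_perm12 b1 r).
rewrite (generic_side gen (b := b2) (b' := b3)) // 1?eq_sym //.
rewrite (generic_side gen_q (b := b1) (b' := b3)) // 1?eq_sym //.
rewrite (generic_side gen_r (b := b1) (b' := b2)) // 1?eq_sym //.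
rewrite (tri_perm12 b1 q r) (tri_perm23 q b1 r) (tri_perm23 p b2 r).
rewrite (generic_joint gen (b := b3)) // (generic_joint gen_pr (b := b2)) //.
rewrite (generic_joint gen_qr (b := b1)) //.
have -> : f b1 b2 b3 = false by apply: B0; rewrite //; distinct.
move=> /(_ isT isT) ->; rewrite add0n addnC addnA addnAC; ring.
Qed.

(** If [p, q, b] behaves as in a split colouring whose side 0 contains the base, its
colour is 1 unless both [p] and [q] lie on side 0. *)
Definition exceptional (p q : T) : bool := joint p q != (side p || side q).

Lemma generic_mixed p q r : generic p q r -> ~~ exceptional p q ->
  ~~ exceptional p r -> ~~ exceptional q r ->
  f p q r = ~~ ((side p == side q) && (side q == side r)).
Proof.
move=> /generic_sum e /negPn/eqP pq /negPn/eqP pr /negPn/eqP qr.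
move: e; rewrite pq pr qr.
by case: (side p); case: (side q); case: (side r); case: (f p q r).
Qed.

(** In the excluded positions [generic_sum] would give the triple [p, q, r] a colour
below 0 or above 1.  Counting pairs between the sides from their end on side 0
makes these positions sufficient. *)
Lemma exceptional_star p q r : generic p q r -> exceptional p q ->
  exceptional p r -> side q = side r -> side p = side q \/ ~~ side p -> False.
Proof.
move=> /generic_sum; rewrite /exceptional => e pq pr sqr sp.
move: e pq pr sp; rewrite sqr.
case: (joint p q); case: (joint p r); case: (joint q r); case: (f p q r);
  case: (side p); case: (side r) => //= _ _ _ [] //.
Qed.
End HomogeneousBase.

(** * From a base to a split colouring *)

Definition count3 (T : finType) (P : T -> T -> T -> bool) : nat :=
  \sum_p \sum_q \sum_r P p q r.
Definition count2 (T : finType) (P : T -> T -> bool) : nat := \sum_p \sum_q P p q.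

Lemma count3_perm (T : finType) (p : {perm T}) (P : T -> T -> T -> bool) :
  count3 (fun x y z => P (p x) (p y) (p z)) = count3 P.
Proof.
rewrite /count3 [RHS](reindex_inj (@perm_inj _ p)); apply: eq_bigr => x _.
rewrite [RHS](reindex_inj (@perm_inj _ p)); apply: eq_bigr => y _.
by rewrite [RHS](reindex_inj (@perm_inj _ p)).
Qed.

Lemma ffact_leq_exp a b : a ^_ b <= a ^ b.
Proof.
elim: b a => [|b IH] a; first by rewrite ffactn0.
rewrite ffactnS expnS leq_mul2l; apply/orP; right.
by apply: leq_trans (IH _) _; case: (b) => // b'; rewrite leq_exp2r ?leq_pred.
Qed.

(** A relabelled octahedron is a uniformly random one; sum over the octahedra with
points in [w]. *)
Lemma imperfect_avg (T : finType) (c : pred {set T}) (w : seq T) : uniq w ->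
  #|T| ^_ 6 * (\sum_(p : {perm T}) ~~ perfect c (map p w)) <=
  #|T|`! * (size w ^ 6 * unbalanced_count c).
Proof.
move=> uw; pose S := [set s : 6.-tuple T | all (mem w) s & uniq s].
have cS : #|S| <= size w ^ 6.
  rewrite /S card_uniq_tuples (card_uniqP uw).
  exact: ffact_leq_exp.
have le (p : {perm T}) : ~~ perfect c (map p w) <= \sum_(s in S) unbalanced c (map p s).
  case: (boolP (perfect c _)) => //= /forallPn[t]; rewrite negb_imply negbK.
  case/andP=> /andP[ut tw] unb.
  pose s := [tuple of map (p^-1)%g t].
  have st : map p s = t.
    by rewrite /= -map_comp map_id_in // => x _ /=; rewrite permKV.
  rewrite (bigD1 s) /=; last first.
    rewrite inE map_inj_uniq ?ut ?andbT; last exact: perm_inj.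
    apply/allP => x xs; have := allP tw (p x).
    have -> : p x \in tval t by rewrite -st map_f.
    by move=> /(_ isT); rewrite /= mem_map //; apply: perm_inj.
  by rewrite st unb.
apply: leq_trans (_ : _ <= #|T| ^_ 6 * (\sum_(p : {perm T}) \sum_(s in S) unbalanced c (map p s))) _.
  by rewrite leq_mul2l leq_sum ?orbT.
rewrite exchange_big big_distrr /=.
have E s : s \in S -> #|T| ^_ 6 * (\sum_(p : {perm T}) unbalanced c (map p s)) =
    #|T|`! * unbalanced_count c.
  rewrite inE => /andP[_ us]; rewrite (perm_avg (fun s => unbalanced c s)) ?size_tuple //.
  congr (_ * _); rewrite /unbalanced_count -sum1_card big_mkcond [RHS]big_mkcond.
  by apply: eq_bigr => q _; rewrite inE; case: (uniq q) => //=; case: (unbalanced c q).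
rewrite (eq_bigr _ E) sum_nat_const mulnCA leq_mul2l; apply/orP; right.
by rewrite leq_mul2r cS orbT.
Qed.

(** Choose the relabelling at random.  The points [p, q, r] are counted through
their labels, which makes every pattern [p, q, r & A] the image of a fixed
sequence. *)
Lemma base_exists (T : finType) (c : pred {set T}) N : N <= #|T| ->
  exists A : seq T, [/\ uniq A, size A = N &
    #|T| ^_ 6 * count3 (fun p q r => uniq [:: p, q, r & A] &&
                          ~~ perfect c [:: p, q, r & A])
      <= #|T| ^ 3 * (N.+3 ^ 6 * unbalanced_count c)].
Proof.
move=> NT; pose L := take N (enum T).
have uL : uniq L by rewrite take_uniq ?enum_uniq.
have sL : size L = N by rewrite size_takel // -cardT.
pose X (p : {perm T}) := count3 (fun x y z => uniq [:: x, y, z & L] &&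
   ~~ perfect c (map p [:: x, y, z & L])).
have [||p Xp] := @exists_le_avg _ (fun p => #|T| ^_ 6 * X p)
    (#|T| ^ 3 * (N.+3 ^ 6 * unbalanced_count c)).
- by rewrite card_perms fact_gt0.
- rewrite card_perms -big_distrr /= /X /count3.
  rewrite exchange_big /= big_distrr /=.
  have -> : #|T|`! * (#|T| ^ 3 * (N.+3 ^ 6 * unbalanced_count c)) =
     \sum_(x : T) \sum_(y : T) \sum_(z : T) #|T|`! * (N.+3 ^ 6 * unbalanced_count c).
    by rewrite !sum_nat_const !cardT -!cardE; ring.
  apply: leq_sum => x _; rewrite exchange_big /= big_distrr /=.
  apply: leq_sum => y _; rewrite exchange_big /= big_distrr /=.
  apply: leq_sum => z _; case u : (uniq [:: x, y, z & L]); last first.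
    by rewrite /= in u; rewrite big1 ?muln0 // => p _; rewrite u.
  have := imperfect_avg c u; rewrite /= sL => h; apply: leq_trans h.
  rewrite leq_mul2l; apply/orP; right; apply: leq_sum => p _.
  by case: (perfect _ _); rewrite ?andbF ?andbT ?leq_b1.
exists (map p L); split; [by rewrite map_inj_uniq //; apply: perm_inj|by rewrite size_map|].
rewrite -(count3_perm p); apply: leq_trans Xp; rewrite leq_mul2l; apply/orP; right.
apply: leq_sum => x _; apply: leq_sum => y _; apply: leq_sum => z _.
have -> : [:: p x, p y, p z & map p L] = map p [:: x, y, z & L] by [].
by rewrite map_inj_uniq //; apply: perm_inj.
Qed.

(** If few ordered triples are stars of [E], then [E] is sparse. *)
Lemma cauchy_schwarz_stars (T : finType) (E : T -> T -> bool) :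
  count2 E ^ 2 <= #|T| * count3 (fun p q r => E p q && E p r).
Proof.
pose d p := \sum_q (E p q : nat).
have -> : count3 (fun p q r => E p q && E p r) = \sum_p d p * d p.
  apply: eq_bigr => p _; rewrite {1}/d big_distrl /=; apply: eq_bigr => q _.
  rewrite /d big_distrr /=; apply: eq_bigr => r _.
  by case: (E p q); case: (E p r).
rewrite -(leq_pmul2l (isT : 0 < 2)).
have -> : 2 * count2 E ^ 2 = \sum_p \sum_q 2 * (d p * d q).
  have -> : count2 E = \sum_p d p by [].
  rewrite -mulnn big_distrl big_distrr /=; apply: eq_bigr => p _.
  by rewrite !big_distrr.
have -> : 2 * (#|T| * (\sum_p d p * d p)) =
    \sum_(p : T) \sum_(q : T) (d p * d p + d q * d q).
  rewrite mul2n -addnn; under [RHS]eq_bigr do rewrite big_split /=.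
  rewrite big_split /=; congr (_ + _); last by rewrite sum_nat_const.
  by rewrite exchange_big /= sum_nat_const.
apply: leq_sum => p _; apply: leq_sum => q _.
by rewrite !mulnn; case: (nat_Cauchy (d p) (d q)).
Qed.

(** The triples meeting both sides of the partition given by [s]. *)
Definition mixed (T : finType) (s : T -> bool) (p q r : T) : bool :=
  ~~ ((s p == s q) && (s q == s r)).

Lemma count3_pairs (T : finType) (E : T -> T -> bool) :
  (count3 (fun p q _ => E p q) = #|T| * count2 E) *
  (count3 (fun p _ r => E p r) = #|T| * count2 E) *
  (count3 (fun _ q r => E q r) = #|T| * count2 E).
Proof.
do !split; rewrite /count3 /count2.
- rewrite big_distrr; apply: eq_bigr => p _ /=; rewrite big_distrr.
  by apply: eq_bigr => q _ /=; rewrite sum_nat_const.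
- by rewrite big_distrr; apply: eq_bigr => p _ /=; rewrite sum_nat_const.
- by rewrite sum_nat_const.
Qed.

Lemma count3_le (T : finType) (P Q : T -> T -> T -> bool) :
  (forall p q r, P p q r -> Q p q r) -> count3 P <= count3 Q.
Proof.
move=> PQ; apply: leq_sum => p _; apply: leq_sum => q _; apply: leq_sum => r _.
by case: (P p q r) (PQ p q r) => // ->.
Qed.

Lemma count3_or (T : finType) (P Q : T -> T -> T -> bool) :
  count3 (fun p q r => P p q r || Q p q r) <= count3 P + count3 Q.
Proof.
rewrite /count3 -big_split; apply: leq_sum => p _ /=.
rewrite -big_split; apply: leq_sum => q _ /=.
rewrite -big_split; apply: leq_sum => r _ /=.
by case: (P p q r); case: (Q p q r).
Qed.

(** [e1] counts the exceptional pairs inside the sides and [e2] those from side 0 to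
side 1; stars of either kind occur only in non-generic triples. *)
Lemma split_near_base (T : finType) (c : pred {set T}) (B : seq T) :
  uniq B -> size B = 6 ->
  {in B & &, forall x y z, uniq [:: x; y; z] -> c (tri x y z) = false} ->
  let Q := count3 (fun p q r => ~~ generic c B p q r) in
  exists (s : T -> bool) (e1 e2 : nat),
    [/\ e1 ^ 2 <= #|T| * Q, e2 ^ 2 <= #|T| * Q &
      count3 (fun p q r => uniq [:: p; q; r] && (c (tri p q r) != mixed s p q r))
        <= Q + 3 * (#|T| * (e1 + 2 * e2))].
Proof.
move=> uB sB B0 Q; pose s := side c B; pose E := exceptional c B.
pose E1 p q := E p q && (s p == s q).
pose E2 p q := [&& E p q, ~~ s p & s q].
exists s, (count2 E1), (count2 E2).
have stars (F : T -> T -> bool) :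
    (forall p q r, F p q -> F p r -> [/\ E p q, E p r, s q = s r & s p = s q \/ ~~ s p]) ->
    count2 F ^ 2 <= #|T| * Q.
  move=> FE; apply: leq_trans (cauchy_schwarz_stars F) _.
  rewrite leq_mul2l; apply/orP; right; apply: count3_le => p q r /andP[Fq Fr].
  apply/negP => gen; have [Eq Er sqr sp] := FE p q r Fq Fr.
  exact: (exceptional_star uB sB B0 gen Eq Er sqr sp).
have Esym p q : E p q = E q p by rewrite /E /exceptional joint_sym // orbC.
have cE : count2 E <= count2 E1 + 2 * count2 E2.
  have sw : count2 E2 = count2 (fun p q => E2 q p) by rewrite /count2 exchange_big.
  rewrite mul2n -addnn {2}sw /count2 -!big_split /=; apply: leq_sum => p _.
  rewrite -!big_split /=; apply: leq_sum => q _.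
  rewrite /E1 /E2 (Esym q p); case: (E p q) => //=.
  by case: (s p); case: (s q).
split.
- apply: stars => p q r /andP[-> /eqP pq] /andP[-> /eqP pr]; split=> //.
    by rewrite -pq.
  by left.
- apply: stars => p q r /and3P[-> p0 q1] /and3P[-> _ r1]; split=> //.
    by rewrite q1 r1.
  by right.
apply: leq_trans (_ : _ <= Q + (#|T| * count2 E + (#|T| * count2 E + #|T| * count2 E))) _;
  last by rewrite leq_add2l; nia.
rewrite -{1}(count3_pairs E).1.1 -{1}(count3_pairs E).1.2 -(count3_pairs E).2.
apply: leq_trans (leq_add (leqnn _) (leq_add (leqnn _) (count3_or _ _))).
apply: leq_trans (leq_add (leqnn _) (count3_or _ _)).
apply: leq_trans (count3_or _ _); apply: count3_le => p q r /andP[u ne].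
case: (boolP (generic c B p q r)) => //= gen.
apply: contraNT ne; rewrite !negb_or => /and3P[pq pr qr].
by rewrite (generic_mixed uB sB B0 gen pq pr qr).
Qed.

Lemma unbalancedC (T : finType) (c : pred {set T}) s :
  unbalanced (predC c) s = unbalanced c s.
Proof.
have sz : size (even_faces s) = size (odd_faces s).
  by case: s => [|a [|a' [|b [|b' [|d [|d' [|? ?]]]]]]].
have cE l : count (predC c) l = size l - count c l.
  by rewrite -(count_predC c l) addKn.
rewrite /unbalanced !cE sz; have := count_size c (even_faces s).
have := count_size c (odd_faces s); rewrite sz => h1 h2.
by congr (~~ _); apply/eqP/eqP; lia.
Qed.

Lemma perfectC (T : finType) (c : pred {set T}) w : perfect (predC c) w = perfect c w.
Proof. by apply: eq_forallb => s; rewrite unbalancedC. Qed.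

Lemma nonuniq_count (T : finType) (A : seq T) : uniq A ->
  count3 (fun p q r => ~~ uniq [:: p, q, r & A]) <=
  #|T| * (#|T| * (3 + 3 * size A)).
Proof.
move=> uA.
have eqc : count2 (fun p q : T => p == q) = #|T|.
  transitivity (\sum_(p : T) 1); last by rewrite sum_nat_const muln1.
  apply: eq_bigr => p _; rewrite (bigD1 p) //= eqxx big1 // => q.
  by rewrite eq_sym => /negPf->.
have inc : count2 (fun p q : T => p \in A) = #|T| * size A.
  rewrite /count2 exchange_big /= sum_nat_const; congr (_ * _).
  rewrite -(card_uniqP uA) -sum1_card [RHS]big_mkcond.
  by apply: eq_bigr => p _; case: (p \in A).
have inc' : count2 (fun p q : T => q \in A) = #|T| * size A.
  by rewrite -inc /count2 exchange_big.
have P := @count3_pairs T; have /= PA := P (fun p q => p \in A).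
have /= PA' := P (fun p q => q \in A); have /= PE := P (fun p q => p == q).
apply: leq_trans (_ : _ <= count3 (fun p q _ : T => p == q) +
  (count3 (fun p _ r : T => p == r) + (count3 (fun _ q r : T => q == r) + (count3 (fun p _ _ => p \in A) +
  (count3 (fun _ q _ => q \in A) + count3 (fun _ _ r => r \in A)))))) _; last first.
  by rewrite !PE !PA !PA' eqc inc inc'; apply: eq_leq; ring.
apply: leq_trans (leq_add (leqnn _) (leq_add (leqnn _) (leq_add (leqnn _) (leq_add (leqnn _) (count3_or _ _))))).
apply: leq_trans (leq_add (leqnn _) (leq_add (leqnn _) (leq_add (leqnn _) (count3_or _ _)))).
apply: leq_trans (leq_add (leqnn _) (leq_add (leqnn _) (count3_or _ _))).
apply: leq_trans (leq_add (leqnn _) (count3_or _ _)).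
apply: leq_trans (count3_or _ _); apply: count3_le => p q r.
rewrite /= uA !inE !negb_and !negb_or !negbK; case: (p == q); case: (p == r); case: (q == r) => //=.
by case: (p \in A); case: (q \in A); case: (r \in A).
Qed.

(** The bit [b] is the colour of the base: the other colour is the one of the mixed
triples. *)
Lemma near_split_colouring : exists N, forall (T : finType) (c : pred {set T}), N <= #|T| ->
  exists (b : bool) (s : T -> bool) (Q e1 e2 : nat),
    [/\ #|T| ^_ 6 * Q <= #|T| ^ 3 * (N.+3 ^ 6 * unbalanced_count c) +
           #|T| ^_ 6 * (#|T| * (#|T| * (3 + 3 * N))),
      e1 ^ 2 <= #|T| * Q, e2 ^ 2 <= #|T| * Q &
      count3 (fun p q r => uniq [:: p; q; r] &&
                           (c (tri p q r) != (b (+) mixed s p q r)))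
        <= Q + 3 * (#|T| * (e1 + 2 * e2))].
Proof.
have [N ramseyN] := link3_ramsey 6; exists N => T c NT.
have [A [uA sA badA]] := base_exists c NT.
have [|b [B [BA sB homB]]] := ramseyN _ (fun x y z => c (tri x y z)) A.
  by rewrite sA.
have uB := subseq_uniq BA uA; have subBA := mem_subseq BA.
pose c' : pred {set T} := fun t => b (+) c t.
have c'perf w : perfect c' w = perfect c w.
  by rewrite /c'; case: (b) => //; apply: perfectC.
have hom' : {in B & &, forall x y z, uniq [:: x; y; z] -> c' (tri x y z) = false}.
  move=> x y z xB yB zB u; rewrite /c'.
  rewrite (link3_sym _ _ homB xB yB zB u) ?addbb // => *.
    exact: congr1 (tri_perm12 _ _ _).
  exact: congr1 (tri_perm23 _ _ _).
have [s [e1 [e2 [h1 h2 h3]]]] := split_near_base uB sB hom'.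
set Q := count3 _ in h1 h2 h3.
exists b, s, Q, e1, e2; split=> //; last first.
  apply: leq_trans h3; apply: count3_le => p q r /andP[-> /=].
  by rewrite /c'; case: (b); case: (c _); case: (mixed _ _ _ _).
have QA : Q <= count3 (fun p q r => uniq [:: p, q, r & A] && ~~ perfect c [:: p, q, r & A])
    + #|T| * (#|T| * (3 + 3 * N)).
  rewrite -sA; apply: leq_trans (leq_add (leqnn _) (nonuniq_count uA)).
  apply: leq_trans (count3_or _ _); apply: count3_le => p q r.
  apply: contraNT; rewrite negb_or negb_and !negbK => /andP[perf u].
  rewrite u /= in perf; rewrite /generic c'perf; apply/andP; split.
    apply: subseq_uniq u; rewrite /= !eqxx //.
  by apply: perfect_sub perf => x; rewrite !inE => /or4P[->|->|->|/subBA->]; rewrite ?orbT.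
by apply: leq_trans (leq_mul (leqnn _) QA) _; rewrite mulnDr leq_add2r.
Qed.

(** * Stability *)

Lemma triple_count_count3 (T : finType) (g : pred {set T}) :
  triple_count g = count3 (fun p q r => uniq [:: p; q; r] && g (tri p q r)).
Proof.
rewrite /triple_count -sum1_card big_mkcond /=.
rewrite /count3 pair_big pair_big /=.
rewrite (reindex (fun t : T * T * T => [tuple t.1.1; t.1.2; t.2])) /=.
  by apply: eq_bigr => t _; rewrite inE /=; case: (_ && g _).
exists (fun q : 3.-tuple T => (tnth q (inord 0), tnth q (inord 1), tnth q (inord 2))).
  by move=> [[x y] z] _ /=; rewrite !(tnth_nth x) /= !inordK.
move=> q _; case: (tupleP q) => x q1; case: (tupleP q1) => y q2.
case: (tupleP q2) => z q3; rewrite (tuple0 q3).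
by apply: val_inj; rewrite /= !(tnth_nth x) /= !inordK.
Qed.

Lemma triple_countC (T : finType) (g : pred {set T}) :
  triple_count g + triple_count (predC g) = #|T| ^_ 3.
Proof.
rewrite -card_uniq_seqs /triple_count -!sum1_card big_mkcond.
rewrite [X in _ + X]big_mkcond [RHS]big_mkcond -big_split /=.
apply: eq_bigr => q _; rewrite !inE.
case: (uniq q) => //=; case: q => [[|x [|y [|z [|? ?]]]]] //= _.
by case: (g _).
Qed.

Lemma count3C (T : finType) (P : T -> T -> T -> bool) :
  count3 P + count3 (fun p q r => ~~ P p q r) = #|T| ^ 3.
Proof.
have -> : #|T| ^ 3 = \sum_(p : T) \sum_(q : T) \sum_(r : T) 1.
  by rewrite !sum_nat_const !expnS expn0 !muln1.
rewrite /count3 -!big_split /=; apply: eq_bigr => p _.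
rewrite -!big_split; apply: eq_bigr => q _ /=.
by rewrite -!big_split; apply: eq_bigr => r _ /=; case: (P p q r).
Qed.

Lemma count3_pure (T : finType) (s : T -> bool) :
  count3 (fun p q r => ~~ mixed s p q r) =
  #|[set p | s p]| ^ 3 + #|[set p | ~~ s p]| ^ 3.
Proof.
have pure (P : pred T) :
    count3 (fun p q r => [&& P p, P q & P r]) = #|[set p | P p]| ^ 3.
  have c1 : \sum_(p : T) (P p : nat) = #|[set p | P p]|.
    rewrite -sum1_card [RHS]big_mkcond; apply: eq_bigr => p _.
    by rewrite inE; case: (P p).
  rewrite /count3 !expnS expn0 muln1 -c1 big_distrl /=; apply: eq_bigr => p _.
  rewrite big_distrl big_distrr /=; apply: eq_bigr => q _.
  rewrite !big_distrr /=; apply: eq_bigr => r _.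
  by case: (P p); case: (P q); case: (P r).
rewrite -(pure s) -(pure (fun p => ~~ s p)) /count3 -!big_split /=.
apply: eq_bigr => p _; rewrite -!big_split; apply: eq_bigr => q _ /=.
rewrite -!big_split; apply: eq_bigr => r _ /=; rewrite /mixed.
by case: (s p); case: (s q); case: (s r).
Qed.

Lemma mixed_change (T : finType) (s s' : T -> bool) :
  count3 (fun p q r => mixed s p q r != mixed s' p q r) <=
  3 * (#|T| * (#|T| * #|[set p | s p != s' p]|)).
Proof.
have c1 : \sum_(p : T) (s p != s' p : nat) = #|[set p | s p != s' p]|.
  rewrite -sum1_card [RHS]big_mkcond; apply: eq_bigr => p _.
  by rewrite inE; case: (_ != _).
pose E1 (p q : T) := s p != s' p; pose E2 (p q : T) := s q != s' q.
have c2 : count2 E1 = #|T| * #|[set p | s p != s' p]|.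
  by rewrite /count2 exchange_big /E1 /= sum_nat_const c1.
have c2' : count2 E2 = #|T| * #|[set p | s p != s' p]|.
  by rewrite /count2 /E2 sum_nat_const c1.
apply: leq_trans (_ : _ <= count3 (fun p q _ => E1 p q) +
  (count3 (fun p q _ => E2 p q) + count3 (fun _ q r => E2 q r))) _.
  apply: leq_trans (leq_add (leqnn _) (count3_or _ _)).
  apply: leq_trans (count3_or _ _); apply: count3_le => p q r.
  by rewrite /mixed /E1 /E2; case: (s p); case: (s q); case: (s r);
    case: (s' p); case: (s' q); case: (s' r).
by rewrite !(count3_pairs E1) !(count3_pairs E2) c2 c2'; apply: eq_leq; ring.
Qed.

(** A set can be changed to any prescribed size by moving no more points than
the sizes require. *)
Lemma subset_of_card (T : finType) (A : {set T}) k : k <= #|T| ->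
  exists X : {set T}, #|X| = k /\
    #|[set p | (p \in A) != (p \in X)]| = (k - #|A|) + (#|A| - k).
Proof.
have sub (B : {set T}) j : j <= #|B| -> exists2 X : {set T}, X \subset B & #|X| = j.
  case/card_geqP => s [us sj sB]; exists [set x in s].
    by apply/subsetP => x; rewrite inE => /sB.
  by rewrite cardsE (card_uniqP us).
move=> kT; case: (leqP k #|A|) => [le|lt].
  have [X XA Xk] := sub A k le; exists X; split=> //.
  have -> : [set p | (p \in A) != (p \in X)] = A :\: X.
    apply/setP => p; rewrite !inE; have := subsetP XA p.
    by case: (p \in X); case: (p \in A) => //= /(_ isT).
  by rewrite cardsD (setIidPr XA) Xk; lia.
have [|Y YA Yk] := sub (~: A) (k - #|A|).
  by have := cardsC A; lia.
have dis : A :&: Y = set0.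
  by apply/eqP; rewrite setI_eq0 disjoint_sym disjoints_subset.
exists (A :|: Y); split; first by rewrite cardsU dis cards0; lia.
have -> : [set p | (p \in A) != (p \in A :|: Y)] = Y.
  apply/setP => p; rewrite !inE; have := subsetP YA p; rewrite inE.
  by case: (p \in Y); case: (p \in A) => //= /(_ isT).
by rewrite Yk; lia.
Qed.

Lemma split_colouring_tri n (X : {set 'I_n}) red p q r :
  split_colouring X (~: X) red (tri p q r) =
  red (+) mixed (fun v => v \in X) p q r.
Proof.
have meetsE (A : {set 'I_n}) :
    meets (tri p q r) A = [|| p \in A, q \in A | r \in A].
  apply/set0Pn/idP => [[x]|].
    rewrite !inE -!orbA => /andP[/or3P[] /eqP -> ->]; rewrite ?orbT //.
  by case/or3P=> h; [exists p|exists q|exists r]; rewrite !inE h eqxx ?orbT.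
rewrite /split_colouring !meetsE /mixed !inE.
by case: (p \in X); case: (q \in X); case: (r \in X); case: red.
Qed.

(** Each switched triple is the underlying set of an ordered one. *)
Lemma switched_count n (c c' : colouring n) :
  #|switched_triples c c'| <=
  count3 (fun p q r => uniq [:: p; q; r] && (c (tri p q r) != c' (tri p q r))).
Proof.
pose P (t : 'I_n * 'I_n * 'I_n) := uniq [:: t.1.1; t.1.2; t.2] &&
  (c (tri t.1.1 t.1.2 t.2) != c' (tri t.1.1 t.1.2 t.2)).
have -> : count3 (fun p q r => uniq [:: p; q; r] && (c (tri p q r) != c' (tri p q r)))
    = #|[set t | P t]|.
  rewrite /count3 pair_big pair_big /= -sum1_card [RHS]big_mkcond.
  by apply: eq_bigr => t _; rewrite inE /P; case: (_ && _).
apply: leq_trans (leq_imset_card (fun t => tri t.1.1 t.1.2 t.2) _).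
apply/subset_leq_card/subsetP => t; rewrite !inE cardE => /andP[].
have := enum_uniq t; have : [set x in enum t] = t.
  by apply/setP => x; rewrite inE mem_enum.
case: (enum t) => [|x [|y [|z [|? ?]]]] //= tE u _ ne.
have {}tE : t = tri x y z by rewrite -tE; apply/setP => v; rewrite !inE orbA.
by apply/imsetP; exists (x, y, z); rewrite ?inE /P /= -?tE ?u ?ne.
Qed.

Local Open Scope ring_scope.

(** With [xi := (3 + sqrt 3) / 6] one has [xi * (1 - xi) = 1 / 6], hence the density
condition reads [3 n (x - xi n) (x - (1 - xi) n)] close to 0, and for [x] at least
[n / 2] the last factor is at least [n / 6]. *)
Lemma side_size (R : realType) (x y n tau : R) :
  x + y = n -> y <= x -> 0 < n -> `|x ^+ 3 + y ^+ 3 - n ^+ 3 / 2| <= tau * n ^+ 3 ->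
  `|x - (3 + Num.sqrt 3) / 6 * n| <= 2 * tau * n.
Proof.
move=> xyn yx n0; set s : R := Num.sqrt 3; set xi := (3 + s) / 6.
have s2 : s * s = 3 by rewrite -expr2 sqr_sqrtr.
have s1 : 1 <= s by rewrite -[leLHS]sqrtr1 ler_wsqrtr //; lra.
have -> : x ^+ 3 + y ^+ 3 - n ^+ 3 / 2 =
    3 * n * ((x - xi * n) * (x - (1 - xi) * n)).
  have e : xi * (1 - xi) = 1 / 6.
    have -> : xi * (1 - xi) = (9 - s * s) / 36 by rewrite /xi; field.
    by rewrite s2; field.
  have -> : (x - xi * n) * (x - (1 - xi) * n) = x ^+ 2 - n * x + xi * (1 - xi) * n ^+ 2 by ring.
  by rewrite e -xyn; field.
rewrite !normrM (gtr0_norm n0) (ger0_norm (_ : 0 <= 3)) //.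
have low : n / 6 <= `|x - (1 - xi) * n|.
  apply: le_trans (ler_norm _).
  have -> : x - (1 - xi) * n = (x - n / 2) + s * n / 6 by rewrite /xi; field.
  have : 1 * n <= s * n by rewrite ler_pM2r.
  lra.
move=> h; have h1 : 3 * n * (`|x - xi * n| * (n / 6)) <= tau * n ^+ 3.
  by apply: le_trans h; rewrite ler_pM2l ?mulr_gt0 // ler_wpM2l.
have h2 : `|x - xi * n| * n ^+ 2 <= 2 * tau * n * n ^+ 2.
  have -> : 2 * tau * n * n ^+ 2 = 2 * (tau * n ^+ 3) by ring.
  have e : `|x - xi * n| * n ^+ 2 = 2 * (3 * n * (`|x - xi * n| * (n / 6))) by field.
  by rewrite e ler_pM2l.
by rewrite ler_pM2r ?exprn_gt0 in h2.
Qed.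

Lemma exp3_leq_ffact n : (3 <= n)%N -> (n ^ 3 <= n ^_ 3 + 3 * n ^ 2)%N.
Proof.
case: n => [|[|[|k]]] // _; rewrite !ffactnS ffactn0 /= !expnS expn0.
have -> : (k.+3 * (k.+2 * (k.+1 * 1)) + 3 * (k.+3 * (k.+3 * 1)) =
  k.+3 * (k.+3 * (k.+3 * 1)) + (2 * k + 6))%N by ring.
exact: leq_addr.
Qed.

(** All errors are measured by [rho]: the colouring differs from the split given by
[s] in at most [10 rho n ^ 3] ordered triples, so the cubes of the side sizes add
up to [n ^ 3 / 2] within [12 rho n ^ 3], the larger side is within [24 rho n] of
its target, and moving that many points (and one for rounding) costs at most
[73 rho n ^ 3] more. *)
Lemma stability (R : realType) (eta : R) : 0 < eta ->
  exists2 delta : R, 0 < delta & exists n0 : nat,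
  forall n, (n0 <= n)%N -> forall c : colouring n,
  (unbalanced_count c)%:R <= delta * (n ^_ 6)%:R :> R ->
  `|(triple_count c)%:R - (n ^_ 3)%:R / 2| <= delta * (n ^_ 3)%:R :> R ->
  exists X Y : {set 'I_n},
        [/\ X :|: Y = [set: 'I_n],
            [disjoint X & Y],
            #|X|%:Z = Num.floor ((3 + Num.sqrt 3) / 6 * n%:R : R) &
            exists red : bool,
              #|switched_triples c (split_colouring X Y red)|%:R
                <= eta * n%:R ^+ 3 :> R].
Proof.
move=> eta0; have [N near] := near_split_colouring.
pose rho : R := Num.min 1 (eta / 83).
have rho0 : 0 < rho by rewrite lt_min ltr01 /= divr_gt0.
have rho1 : rho <= 1 by rewrite ge_min lexx.
have rhoe : 83 * rho <= eta.
  have : rho <= eta / 83 by rewrite ge_min lexx orbT.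
  lra.
pose C1 : R := (N.+3 ^ 6)%:R; pose C2 : R := (3 + 3 * N)%:R.
have C1_1 : 1 <= C1 by rewrite ler1n expn_gt0.
have C2_3 : 3 <= C2 by rewrite ler_nat leq_addr.
(* With this [delta], each of the two terms that bound [Q] is at most half of
   [rho ^+ 2 * n ^+ 3], the second one for large [n]. *)
pose delta := rho ^+ 2 / (2 * C1).
have delta0 : 0 < delta by rewrite divr_gt0 ?exprn_gt0 ?mulr_gt0 //; lra.
have deltaC : delta * C1 = rho ^+ 2 / 2 by rewrite /delta; field; lra.
have rho2 : rho ^+ 2 <= rho by rewrite expr2 ler_piMr // ltW.
have delta_rho : delta <= rho / 2.
  have : delta * 1 <= delta * C1 by rewrite ler_pM2l.
  rewrite deltaC; lra.
exists delta => //.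
pose M : R := 2 * C2 / rho ^+ 2.
exists (maxn (maxn N 6) (Num.Def.archi_bound M)) => n; rewrite !geq_max.
move=> /andP[/andP[nN n6] nM] c U_small D_half.
have n_gt0 : (0 : R) < n%:R by rewrite ltr0n; apply: leq_trans n6.
have nC2 : 2 * C2 <= n%:R * rho ^+ 2.
  have M0 : 0 <= M by rewrite divr_ge0 ?mulr_ge0 ?exprn_ge0 //; lra.
  have : M <= n%:R.
    by apply/ltW/(lt_le_trans (archi_boundP M0)); rewrite ler_nat.
  by rewrite /M ler_pdivrMr ?exprn_gt0.
have nrho : 6 <= n%:R * rho.
  have : n%:R * rho ^+ 2 <= n%:R * rho by rewrite ler_pM2l.
  lra.
have := near 'I_n c; rewrite !card_ord => /(_ nN)[b [s [Q [e1 [e2 [hQ h1 h2 hW]]]]]].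
set F6 : R := (n ^_ 6)%:R in U_small.
have F6_0 : 0 < F6 by rewrite ltr0n ffact_gt0.
set n' : R := n%:R in n_gt0 nC2 nrho *.
have Qb : Q%:R <= rho ^+ 2 * n' ^+ 3.
  have : F6 * Q%:R <= F6 * (n' ^+ 3 * (C1 * delta) + n' * (n' * C2)).
    have : F6 * Q%:R <= n' ^+ 3 * (C1 * (unbalanced_count c)%:R) + F6 * (n' * (n' * C2)).
      by rewrite /F6 /n' /C1 /C2 -natrX -!natrM -natrD ler_nat.
    move/le_trans; apply.
    rewrite (mulrDr F6 (n' ^+ 3 * (C1 * delta))) lerD2r.
    have -> : F6 * (n' ^+ 3 * (C1 * delta)) = n' ^+ 3 * (C1 * (delta * F6)) by ring.
    by rewrite ler_pM2l ?exprn_gt0 // ler_pM2l //; lra.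
  rewrite ler_pM2l // [C1 * _]mulrC deltaC => /le_trans; apply.
  have : n' ^+ 2 * (2 * C2) <= n' ^+ 2 * (n' * rho ^+ 2) by rewrite ler_pM2l ?exprn_gt0.
  have -> : n' ^+ 2 * (n' * rho ^+ 2) = rho ^+ 2 * n' ^+ 3 by ring.
  have -> : n' * (n' * C2) = n' ^+ 2 * (2 * C2) / 2 by field.
  have -> : n' ^+ 3 * (rho ^+ 2 / 2) = rho ^+ 2 * n' ^+ 3 / 2 by field.
  lra.
have eb e : (e ^ 2 <= n * Q)%N -> e%:R <= rho * n' ^+ 2.
  move=> he; rewrite -(@ler_pXn2r _ 2) ?nnegrE ?ler0n ?mulr_ge0 ?exprn_ge0 ?(ltW rho0) ?(ltW n_gt0) //.
  move: he; rewrite -(ler_nat R) natrM natrX -/n' => /le_trans; apply.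
  have -> : (rho * n' ^+ 2) ^+ 2 = n' * (rho ^+ 2 * n' ^+ 3) by ring.
  by rewrite ler_pM2l.
have e1b := eb _ h1; have e2b := eb _ h2.
set W := count3 _ in hW.
have Wb : W%:R <= 10 * rho * n' ^+ 3.
  move: hW; rewrite -(ler_nat R) natrD !natrM natrD natrM -/n' => /le_trans; apply.
  have : n' * (e1%:R + 2 * e2%:R) <= n' * (3 * (rho * n' ^+ 2)).
    by rewrite ler_pM2l //; lra.
  have -> : n' * (3 * (rho * n' ^+ 2)) = 3 * (rho * n' ^+ 3) by ring.
  have : rho ^+ 2 * n' ^+ 3 <= rho * n' ^+ 3 by rewrite ler_pM2r ?exprn_gt0.
  have -> : 10 * rho * n' ^+ 3 = 10 * (rho * n' ^+ 3) by ring.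
  lra.
pose x := #|[set p | s p]|; pose y := #|[set p | ~~ s p]|.
have xy : (x + y = n)%N.
  rewrite -[RHS](card_ord n) -(cardsC [set p | s p]); congr (_ + _)%N.
  by apply: eq_card => p; rewrite !inE.
have cubes : `|x%:R ^+ 3 + y%:R ^+ 3 - n' ^+ 3 / 2| <= 12 * rho * n' ^+ 3.
  pose B3 := count3 (fun p q r => b (+) mixed s p q r).
  have DB : (triple_count c <= B3 + W)%N.
    rewrite triple_count_count3; apply: leq_trans (count3_or _ _).
    apply: count3_le => p q r /andP[-> ->].
    by case: (b (+) _).
  have BD : (B3 <= triple_count c + (W + 3 * n ^ 2))%N.
    have := @nonuniq_count 'I_n [::] isT; rewrite card_ord muln0 addn0 mulnA mulnn mulnC => nu.
    rewrite triple_count_count3; apply: leq_trans (leq_add (leqnn _) (leq_add (leqnn _) nu)).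
    apply: leq_trans (leq_add (leqnn _) (count3_or _ _)).
    apply: leq_trans (count3_or _ _); apply: count3_le => p q r.
    by case: (uniq _); case: (c _); case: (b (+) _).
  have B3E : if b then (B3 = x ^ 3 + y ^ 3)%N else (B3 + (x ^ 3 + y ^ 3) = n ^ 3)%N.
    have := count3C (mixed s); rewrite count3_pure card_ord -/x -/y /B3.
    by case: (b) => //= _; rewrite -count3_pure.
  have F3l : (n ^_ 3 <= n ^ 3)%N by exact: ffact_leq_exp.
  have F3u : (n ^ 3 <= n ^_ 3 + 3 * n ^ 2)%N.
    by apply: exp3_leq_ffact; apply: leq_trans n6.
  have sq : 6 * n' ^+ 2 <= rho * n' ^+ 3.
    have -> : rho * n' ^+ 3 = n' ^+ 2 * (n' * rho) by ring.
    by rewrite mulrC ler_pM2l ?exprn_gt0.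
  have dF : delta * (n ^_ 3)%:R <= rho * n' ^+ 3 / 2.
    apply: le_trans (_ : delta * n' ^+ 3 <= _).
      by rewrite ler_pM2l // /n' -natrX ler_nat.
    have -> : rho * n' ^+ 3 / 2 = rho / 2 * n' ^+ 3 by field.
    by rewrite ler_pM2r ?exprn_gt0.
  have DB' : (triple_count c)%:R <= B3%:R + W%:R :> R by rewrite -natrD ler_nat.
  have BD' : B3%:R <= (triple_count c)%:R + (W%:R + 3 * n' ^+ 2).
    by rewrite /n' -natrX -natrM -!natrD ler_nat.
  have F3l' : (n ^_ 3)%:R <= n' ^+ 3 by rewrite /n' -natrX ler_nat.
  have F3u' : n' ^+ 3 <= (n ^_ 3)%:R + 3 * n' ^+ 2.
    by rewrite /n' -!natrX -natrM -natrD ler_nat.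
  move: D_half; rewrite !ler_norml => /andP[D1 D2].
  have -> : 12 * rho * n' ^+ 3 = 12 * (rho * n' ^+ 3) by ring.
  move: Wb; have -> : 10 * rho * n' ^+ 3 = 10 * (rho * n' ^+ 3) by ring.
  move=> Wb.
  have sq0 : 0 <= n' ^+ 2 by rewrite exprn_ge0 // ltW.
  move: B3E; case: (b).
    move=> B3E; have B3R : B3%:R = x%:R ^+ 3 + y%:R ^+ 3 :> R.
      by rewrite B3E natrD !natrX.
    by apply/andP; split; lra.
  move=> B3E; have B3R : B3%:R + (x%:R ^+ 3 + y%:R ^+ 3) = n' ^+ 3 :> R.
    by rewrite /n' -!natrX -!natrD B3E.
  by apply/andP; split; lra.
have [s' [mixE yx]] : exists s' : 'I_n -> bool, 
    (forall p q r, mixed s' p q r = mixed s p q r) /\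
    let a := #|[set p | s' p]|%:R in
    `|a - (3 + Num.sqrt 3) / 6 * n'| <= 2 * (12 * rho) * n'.
  have xyR : x%:R + y%:R = n' by rewrite -natrD xy.
  case: (leP (y%:R : R) x%:R) => [le|lt].
    by exists s; split=> //; apply: side_size cubes.
  exists (fun p => ~~ s p); split.
    by move=> p q r; rewrite /mixed; case: (s p); case: (s q); case: (s r).
  apply: (side_size (y := x%:R)) => //; first by rewrite addrC.
    exact: ltW.
  by rewrite [_%:R ^+ 3 + _]addrC.
set xi := (3 + Num.sqrt 3) / 6 in yx *; move: yx.
set A := [set p | s' p] => /= yx.
have xi0 : 0 <= xi by rewrite divr_ge0 ?addr_ge0 ?sqrtr_ge0.
have xi1 : xi <= 1.
  rewrite /xi ler_pdivrMr // mul1r -lerBrDl.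
  have -> : 6 - 3 = Num.sqrt (3 ^+ 2) :> R by rewrite sqrtr_sqr ger0_norm //; lra.
  by rewrite ler_wsqrtr //; lra.
pose k := `|Num.floor (xi * n')|%N.
have kE : k%:Z = Num.floor (xi * n').
  by rewrite /k gez0_abs // floor_ge0 mulr_ge0 // ltW.
have k_le : k%:R <= xi * n'.
  by have := floor_le_tmp (xi * n'); rewrite -kE.
have k_gt : xi * n' < k%:R + 1.
  by have := floorD1_gt (xi * n'); rewrite -kE intrD.
have kn : (k <= #|'I_n|)%N.
  rewrite card_ord -(ler_nat R); apply: le_trans k_le _.
  by rewrite -/n' ler_piMl // ltW.
have [X [Xk dX]] := subset_of_card A kn.
exists X, (~: X); split.
- by rewrite setUCr.
- by rewrite disjoints_subset setCK.
- by rewrite Xk.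
exists b.
have dXb : #|[set p | (p \in A) != (p \in X)]|%:R <= 24 * rho * n' + 1.
  rewrite dX natrD; move: yx k_le k_gt; rewrite ler_norml => /andP[y1 y2] k_le k_gt.
  case: (leqP k #|A|) => [kA|Ak].
    rewrite (eqP kA) add0r natrB //; lra.
  by rewrite natrB ?(ltnW Ak) // (eqP (ltnW Ak)) addr0; lra.
have total : (#|switched_triples c (split_colouring X (~: X) b)| <=
    W + 3 * (n * (n * #|[set p | (p \in A) != (p \in X)]|)))%N.
  apply: leq_trans (switched_count _ _) _.
  have := mixed_change (fun p => p \in A) (fun p => p \in X).
  rewrite card_ord => mc; apply: leq_trans (leq_add (leqnn _) mc).
  apply: leq_trans (count3_or _ _); apply: count3_le => p q r /andP[-> /=].
  rewrite split_colouring_tri.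
  have -> : mixed (fun p => p \in A) p q r = mixed s p q r.
    by rewrite -mixE /mixed !inE.
  by case: (c _); case: (b); case: (mixed s p q r); case: (mixed _ _ _ _).
apply: le_trans (_ : _ <= 83 * rho * n' ^+ 3) _; last first.
  by rewrite ler_pM2r ?exprn_gt0.
move: total; rewrite -(ler_nat R) natrD !natrM -/n' => /le_trans; apply.
have : n' * (n' * #|[set p | (p \in A) != (p \in X)]|%:R) <= n' * (n' * (24 * rho * n' + 1)).
  by rewrite !ler_pM2l.
have -> : n' * (n' * (24 * rho * n' + 1)) = 24 * (rho * n' ^+ 3) + n' ^+ 2 by ring.
have : n' ^+ 2 * 6 <= n' ^+ 2 * (n' * rho) by rewrite ler_pM2l ?exprn_gt0.
have -> : n' ^+ 2 * (n' * rho) = rho * n' ^+ 3 by ring.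
move: Wb; have -> : 10 * rho * n' ^+ 3 = 10 * (rho * n' ^+ 3) by ring.
have -> : 83 * rho * n' ^+ 3 = 83 * (rho * n' ^+ 3) by ring.
have := exprn_gt0 2 n_gt0.
lra.
Qed.

(** * Excess over the average *)

Lemma sts_is_steiner n (S : {set {set 'I_n}}) : sts S -> is_steiner_triple_system S.
Proof.
move=> [S3 Sc]; split; first by apply/subsetP => t /S3; rewrite inE => ->.
move=> e /eqP/cards2P[x [y [xy ->]]]; apply: etrans (Sc x y xy); apply: eq_card => t.
by rewrite !inE subUset !sub1set.
Qed.

Lemma sq_leq_bin n : (9 <= n)%N -> (4 * n ^ 2 <= 9 * 'C(n, 2))%N.
Proof.
move=> n9; rewrite -(leq_pmul2l (isT : (0 < 2)%N)).
have -> : (2 * (9 * 'C(n, 2)) = n * (9 * n.-1))%N.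
  by rewrite mulnCA -mul_bin_diag bin1 mulnCA.
have -> : (2 * (4 * n ^ 2) = n * (8 * n))%N by rewrite -mulnn; ring.
by rewrite leq_mul2l; apply/orP; right; lia.
Qed.

Lemma sts_beats_average_ratio (R : realType) n (g : pred {set 'I_n}) m : (6 <= n)%N ->
  pasch_rich 'I_n m ->
  exists2 S : {set {set 'I_n}}, sts S &
    ('C(n, 2))%:R / 3 * ((triple_count g)%:R / (n ^_ 3)%:R) +
    m%:R * ((unbalanced_count g)%:R / (n ^_ 6)%:R) / 2
      <= #|[set t in S | g t]|%:R :> R.
Proof.
move=> n6 rich; have [S sS le] := sts_beats_average g rich.
exists S => //; move: le; rewrite card_ord.
have := card_sts sS; rewrite card_ord.
set F3 := (n ^_ 3)%N; set F6 := (n ^_ 6)%N.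
have F3_0 : (0 : R) < F3%:R by rewrite ltr0n ffact_gt0; lia.
have F6_0 : (0 : R) < F6%:R by rewrite ltr0n ffact_gt0.
set D := triple_count g; set U := unbalanced_count g.
move: F3 F6 D U F3_0 F6_0 => F3 F6 D U F3_0 F6_0 cS.
have -> : 'C(n, 2)%:R / 3 = #|S|%:R :> R.
  have : (3 * #|S| = 'C(n, 2))%N.
    by rewrite bin2 -cS; lia.
  by move=> <-; rewrite natrM; field.
rewrite -(ler_nat R) natrD !natrM => le.
have e : (2 * F3%:R * F6%:R) * (#|S|%:R * (D%:R / F3%:R) + m%:R * (U%:R / F6%:R) / 2)
   = #|S|%:R * D%:R * F6%:R * 2 + m%:R * U%:R * F3%:R :> R.
  by field; rewrite !gt_eqF.
by move: le; rewrite -e ler_pM2l // !mulr_gt0.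
Qed.

Theorem theorem1p2 (R : realType) (eta : R) (eta_gt0 : 0 < eta) :
  exists mu : R, 0 < mu /\
  exists n0 : nat, forall n : nat, (n0 <= n)%N ->
    (n = 1 %[mod 6] \/ n = 3 %[mod 6])%N ->
  forall c : colouring n,
    (exists (S : {set {set 'I_n}}) (b : bool),
        is_steiner_triple_system S /\
        1 / 2 * (1 / 3) * ('C(n, 2))%:R + mu * n%:R ^+ 2
          <= #|edges_of_colour c b S|%:R :> R)
    \/
    (exists X Y : {set 'I_n},
        [/\ X :|: Y = [set: 'I_n],
            [disjoint X & Y],
            #|X|%:Z = Num.floor ((3 + Num.sqrt 3) / 6 * n%:R : R) &
            exists red : bool,
              #|switched_triples c (split_colouring X Y red)|%:R
                <= eta * n%:R ^+ 3 :> R]).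
Proof.
have [delta delta0 [n0 stab]] := stability eta_gt0.
exists (delta / 2000); split; first by rewrite divr_gt0.
exists (maxn n0 100) => n; rewrite geq_max => /andP[nn0 n100] n16 c.
have n6 : (6 <= n)%N by apply: leq_trans n100.
have [m rich mn] := exists_pasch_rich n100 n16.
have mn' : n%:R ^+ 2 <= 1000 * m%:R :> R by rewrite -natrX -natrM ler_nat.
have F3_0 : (0 : R) < (n ^_ 3)%:R by rewrite ltr0n ffact_gt0; apply: leq_trans n6.
have F6_0 : (0 : R) < (n ^_ 6)%:R by rewrite ltr0n ffact_gt0.
have binE : 4 * n%:R ^+ 2 <= 9 * 'C(n, 2)%:R :> R.
  by rewrite -natrX -!natrM ler_nat; apply: sq_leq_bin; apply: leq_trans n100.
(* A colour of density at least 1/2 wins with either source of excess; for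
   unbalanced octahedra it does not matter which colour is counted. *)
have win (b : bool) (g : pred {set 'I_n}) : (forall t, (c t == b) = g t) ->
    (1 / 2 <= (triple_count g)%:R / (n ^_ 3)%:R :> R) ->
    (1 / 2 + delta <= (triple_count g)%:R / (n ^_ 3)%:R :> R) \/
    (delta <= (unbalanced_count g)%:R / (n ^_ 6)%:R :> R) ->
    exists (S : {set {set 'I_n}}) (b : bool), is_steiner_triple_system S /\
        1 / 2 * (1 / 3) * ('C(n, 2))%:R + delta / 2000 * n%:R ^+ 2
          <= #|edges_of_colour c b S|%:R :> R.
  move=> gE half excess; have [S sS le] := sts_beats_average_ratio R g n6 rich.
  exists S, b; split; first exact: sts_is_steiner.
  have -> : edges_of_colour c b S = [set t in S | g t].
    by apply/setP => t; rewrite !inE gE.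
  apply: le_trans le.
  set B : R := 'C(n, 2)%:R in binE *.
  set p := (triple_count g)%:R / _ in half excess *.
  set u := (unbalanced_count g)%:R / _ in excess *.
  have u0 : 0 <= u by rewrite divr_ge0 ?ler0n.
  have B0 : 0 <= B by rewrite ler0n.
  have nsq : delta * n%:R ^+ 2 <= delta * (1000 * m%:R) by rewrite ler_pM2l.
  have nsqB : delta * (4 * n%:R ^+ 2) <= delta * (9 * B) by rewrite ler_pM2l.
  case: excess => ex.
    have : B / 3 * (1 / 2 + delta) <= B / 3 * p by rewrite ler_wpM2l // divr_ge0.
    have : 0 <= m%:R * u by rewrite mulr_ge0.
    have : 0 <= delta * n%:R ^+ 2 by rewrite mulr_ge0 ?exprn_ge0 // ltW.
    have -> : B / 3 * (1 / 2 + delta) = B / 6 + delta * (9 * B) / 27 by field.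
    lra.
  have : B / 3 * (1 / 2) <= B / 3 * p by rewrite ler_wpM2l // divr_ge0.
  have : m%:R * delta <= m%:R * u by rewrite ler_wpM2l.
  lra.
have DC : (triple_count c)%:R / (n ^_ 3)%:R +
    (triple_count (predC c))%:R / (n ^_ 3)%:R = 1 :> R.
  rewrite -mulrDl -natrD triple_countC card_ord divff // gt_eqF //.
have UC : unbalanced_count (predC c) = unbalanced_count c.
  by apply: eq_card => q; rewrite !inE unbalancedC.
have winT := win true c; have winF := win false (predC c).
have gT t : (c t == true) = c t by rewrite eqb_id.
have gF t : (c t == false) = predC c t by rewrite eqbF_neg.
move/(_ gT): winT => winT; move/(_ gF): winF => winF.
rewrite UC in winF.
have [Ularge|Usmall] := lerP delta ((unbalanced_count c)%:R / (n ^_ 6)%:R).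
  left; have [h|h] := lerP (1 / 2) ((triple_count c)%:R / (n ^_ 3)%:R : R).
    by apply: winT => //; right.
  by apply: winF; [lra|right].
have [h1|h1] := lerP (1 / 2 + delta) ((triple_count c)%:R / (n ^_ 3)%:R : R).
  by left; apply: winT; [lra|left].
have [h2|h2] := lerP (1 / 2 + delta) ((triple_count (predC c))%:R / (n ^_ 3)%:R : R).
  by left; apply: winF; [lra|left].
right; apply: (stab n nn0 c).
  by rewrite -ler_pdivrMr // ltW.
set p := (triple_count c)%:R / _ in DC h1.
have -> : (triple_count c)%:R - (n ^_ 3)%:R / 2 = (p - 1 / 2) * (n ^_ 3)%:R :> R.
  by rewrite /p; field; rewrite gt_eqF.
rewrite normrM (gtr0_norm F3_0) ler_pM2r // ler_norml; lra.
Qed.
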